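(* Let $b>0$ and let $\mathcal{K}$ be the flat Klein bottle $$\mathcal{K}=\mathbb{R}^2\big/\bigl\{(x_1,x_2)\sim(1+x_1,x_2)\sim(1-x_1,b+x_2)\bigr\}.$$ Then for all sufficiently large $t$, the heat kernel $K_t$ on $\mathcal{K}$ is not geodesically decreasing.
   Context: $\mathcal{K}$ is the quotient of $\mathbb{R}^2$ by the group of isometries generated by $(x_1,x_2)\mapsto(1+x_1,x_2)$ and $(x_1,x_2)\mapsto(1-x_1,b+x_2)$, with the induced flat metric. The heat kernel $K_t(x,y)$ is the fundamental solution of $\partial_t u=\Delta u$, where $\Delta$ is the Laplace-Beltrami operator on $\mathcal{K}$. A minimal geodesic is a geodesic whose length equals the distance between its endpoints. A function $G$ on $M\times M$, with $M$ a Riemannian manifold, is geodesically decreasing if for each $x\in M$ and every minimal geodesic $\gamma:[0,s_0]\to M$ with $\gamma(0)=x$, the function $s\mapsto G(x,\gamma(s))$ is non-increasing. *)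

(* Defs.v *)
From Stdlib Require Import Reals Lra Relations.
From Coquelicot Require Import Coquelicot.
Open Scope R_scope.

(** * The flat Klein bottle *)

Definition klein_step (b : R) (p q : R * R) : Prop :=
  q = (1 + fst p, snd p) \/ q = (1 - fst p, b + snd p).

(** The classes of this relation are the orbits of the group generated by the
    two isometries. *)
Definition klein_eq (b : R) : relation (R * R) :=
  clos_refl_sym_trans (R * R) (klein_step b).

Definition klein (b : R) : Type :=
  { S : R * R -> Prop | exists p, S = klein_eq b p }.

Definition proj (b : R) (p : R * R) : klein b :=
  exist _ (klein_eq b p) (ex_intro _ p eq_refl).

(** The projection [proj b] is a covering map and a local isometry.  Hence
    continuity (for the quotient topology), partial derivatives, the Laplacian,
    and lengths of curves are all expressed through lifts to the plane. *)

(** * Curves, lengths, geodesics *)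

Definition speed (c : R -> R * R) (s : R) : R :=
  sqrt (Derive (fun r => fst (c r)) s ^ 2 + Derive (fun r => snd (c r)) s ^ 2).

Definition curve_length (c : R -> R * R) (s0 : R) : R := RInt (speed c) 0 s0.

Definition C1_curve (c : R -> R * R) : Prop :=
  forall s,
    ex_derive (fun r => fst (c r)) s /\ ex_derive (fun r => snd (c r)) s /\
    continuous (Derive (fun r => fst (c r))) s /\
    continuous (Derive (fun r => snd (c r))) s.

(** Riemannian distance: infimum of the lengths of the C^1 curves on the Klein
    bottle joining [x] to [y]; such curves are the projections of C^1 curves of
    the plane, and a C^1 curve on [[0,1]] extends to one on the line. *)
Definition klein_dist (b : R) (x y : klein b) : R :=
  real (Glb_Rbar (fun l => exists c : R -> R * R,
    C1_curve c /\ proj b (c 0) = x /\ proj b (c 1) = y /\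
    l = curve_length c 1)).

(** Geodesic equation in flat coordinates. *)
Definition plane_geodesic (c : R -> R * R) : Prop :=
  forall s,
    ex_derive (fun r => fst (c r)) s /\ ex_derive (fun r => snd (c r)) s /\
    is_derive (Derive (fun r => fst (c r))) s 0 /\
    is_derive (Derive (fun r => snd (c r))) s 0.

Definition minimal_geodesic (b : R) (gamma : R -> klein b) (s0 : R) : Prop :=
  exists c : R -> R * R,
    plane_geodesic c /\
    (forall s, 0 <= s <= s0 -> gamma s = proj b (c s)) /\
    curve_length c s0 = klein_dist b (gamma 0) (gamma s0).

Definition geodesically_decreasing (b : R) (G : klein b -> klein b -> R) : Prop :=
  forall (x : klein b) (s0 : R) (gamma : R -> klein b),
    0 <= s0 -> minimal_geodesic b gamma s0 -> gamma 0 = x ->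
    forall s s', 0 <= s -> s <= s' -> s' <= s0 ->
      G x (gamma s') <= G x (gamma s).

(** * The heat kernel *)

Definition partial1 (f : R * R -> R) (p : R * R) : R :=
  Derive (fun r => f (r, snd p)) (fst p).

Definition partial2 (f : R * R -> R) (p : R * R) : R :=
  Derive (fun r => f (fst p, r)) (snd p).

Definition ex_partials (f : R * R -> R) : Prop :=
  forall p, ex_derive (fun r => f (r, snd p)) (fst p) /\
            ex_derive (fun r => f (fst p, r)) (snd p).

Definition laplacian (f : R * R -> R) (p : R * R) : R :=
  partial1 (partial1 f) p + partial2 (partial2 f) p.

Definition time_partial (u : R -> R * R -> R) (t : R) (p : R * R) : R :=
  Derive (fun r => u r p) t.

Definition continuous_pos_time (u : R -> R * R -> R) : Prop :=
  forall t p, 0 < t ->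
    continuous (fun z : R * (R * R) => u (fst z) (snd z)) (t, p).

(** C^1 in time and C^2 in space, for positive times, with all these
    derivatives continuous in time and space jointly. *)
Definition C12 (u : R -> R * R -> R) : Prop :=
  (forall t p, 0 < t -> ex_derive (fun r => u r p) t) /\
  (forall t, 0 < t ->
    ex_partials (u t) /\ ex_partials (partial1 (u t)) /\
    ex_partials (partial2 (u t))) /\
  continuous_pos_time u /\
  continuous_pos_time (time_partial u) /\
  continuous_pos_time (fun t => partial1 (u t)) /\
  continuous_pos_time (fun t => partial2 (u t)) /\
  continuous_pos_time (fun t => partial1 (partial1 (u t))) /\
  continuous_pos_time (fun t => partial1 (partial2 (u t))) /\
  continuous_pos_time (fun t => partial2 (partial1 (u t))) /\
  continuous_pos_time (fun t => partial2 (partial2 (u t))).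

Definition klein_continuous (b : R) (f : klein b -> R) : Prop :=
  forall p, continuous (fun q : R * R => f (proj b q)) p.

(** Integral of a continuous function against the Riemannian area:
    [[0,1] x [0,b]] is a fundamental domain for the group. *)
Definition klein_integral (b : R) (f : klein b -> R) : R :=
  RInt (fun x1 => RInt (fun x2 => f (proj b (x1, x2))) 0 b) 0 1.

(** Fundamental solution: jointly continuous, a classical solution of the heat
    equation in the first variable, converging to the Dirac mass at [y] as [t]
    tends to 0 from the right.  Only the values at positive times matter. *)
Definition is_heat_kernel (b : R) (K : R -> klein b -> klein b -> R) : Prop :=
  (forall t p q, 0 < t ->
    continuous (fun z : R * ((R * R) * (R * R)) =>
      K (fst z) (proj b (fst (snd z))) (proj b (snd (snd z)))) (t, (p, q))) /\
  (forall y, C12 (fun t p => K t (proj b p) y)) /\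
  (forall t p y, 0 < t ->
    time_partial (fun r q => K r (proj b q) y) t p =
    laplacian (fun q => K t (proj b q) y) p) /\
  (forall y f, klein_continuous b f ->
    filterlim (fun t => klein_integral b (fun x => K t x y * f x))
      (at_right 0) (locally (f y))).

(* Main.v *)
(** On a horizontal segment the modes of the heat kernel that depend on [x2] alone
    cancel, so the slowest decaying contribution to [K_t(x, y0) - K_t(x, y1)] comes
    from [cos(2 pi x1) cos(2 pi y1)].  For [x = y1 = (1/8, 0)] and [y0 = (0, 0)] that
    contribution is positive: at large times the kernel is smaller on the diagonal at
    [x] than at [y0], the other end of a minimal geodesic issued from [x].

    The Fourier coefficients of [K_t(., y)] satisfy [a' = - lambda a] with initial
    value prescribed by the Dirac mass, so they are known exactly.  A pointwise value
    is recovered from finitely many of them at a time by integrating against a product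
    of Fejer kernels; the resulting finite sums are bounded below uniformly in the
    order of the kernel, so that no infinite Fourier series is needed. *)
Require Import Defs.
From Stdlib Require Import Reals ZArith Lra Lia Relations Classical ClassicalEpsilon.
From Stdlib Require Import FunctionalExtensionality PropExtensionality ProofIrrelevance.
From Coquelicot Require Import Coquelicot.
Open Scope R_scope.

(** * Parametric and double integrals *)

(** The modes in [x2] alone have rates that are multiples of [(PI / b) ^ 2], for large [b] slower
    than the rate [4 * PI ^ 2] of [cos (2 * PI * x1)]; comparing two poles at the same height
    removes them for every [b]. The glide reflection breaks the invariance in [x1]: among the modes
    of frequency 1 that do not depend on [x2], only the cosine survives. So the relevant part of the
    kernel on the diagonal is proportional to [cos (2 * PI * x1) ^ 2], against [cos (2 * PI * x1)]
    once the pole is moved to 0. The latter is larger wherever this cosine lies strictly between 0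
    and 1, for instance at [1/8].

    Monotonicity concerns the second argument of the kernel, the heat equation the first. Hence the
    object studied is [w = K_t(., y0) - K_t(., y1)], and the claim is [w(x) > 0]. If [w(x) <= 0], a
    one-sided bound on [w] makes its integrals against Fejer kernels peaked at [x] too small for the
    lower bound on the mode sums. A product of Fejer kernels is not invariant under the glide
    reflection, so its image is added to it. *)

Lemma continuous_on_segment_uniform {U : UniformSpace} (f : U -> R -> R) (a b : R)
    (u0 : U) (eps : R) :
  0 < eps ->
  (forall x, a <= x <= b ->
    continuous (fun z : U * R => f (fst z) (snd z)) (u0, x)) ->
  locally u0 (fun u => forall x, a <= x <= b -> Rabs (f u x - f u0 x) < eps).
Proof.
intros Heps Hf.
assert (Hd : forall t, exists d : posreal, a <= t <= b ->
    forall u x, ball u0 d u -> Rabs (x - t) < d -> Rabs (f u x - f u0 t) < eps / 2).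
{ intros t.
  destruct (classic (a <= t <= b)) as [Ht|Ht].
  - assert (He : 0 < eps / 2) by lra.
    destruct (proj1 (filterlim_locally _ _) (Hf t Ht) (mkposreal _ He)) as [d Hd].
    exists d; intros _ u x Hu Hx.
    apply (Hd (u, x)); split; [exact Hu|exact Hx].
  - exists (mkposreal 1 Rlt_0_1); tauto. }
pose (delta t := proj1_sig (constructive_indefinite_description _ (Hd t))).
assert (Hdelta : forall t, a <= t <= b ->
    forall u x, ball u0 (delta t) u -> Rabs (x - t) < delta t ->
    Rabs (f u x - f u0 t) < eps / 2).
{ intros t; exact (proj2_sig (constructive_indefinite_description _ (Hd t))). }
(* A single radius [d] serves the whole segment: each [x] is within [delta t] of some [t] with
   [d <= delta t]. That statement comes doubly negated, hence [NNPP]. *)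
destruct (compactness_value_1d a b delta) as [d Hd'].
exists d; intros u Hu x Hx.
apply NNPP; intros Hn; apply (Hd' x Hx); intros [t [Ht [Hxt Hdt]]]; apply Hn.
assert (H1 := Hdelta t Ht u x (ball_le _ _ _ Hdt _ Hu) Hxt).
assert (H2 := Hdelta t Ht u0 x (ball_center _ _) Hxt).
replace (f u x - f u0 x) with ((f u x - f u0 t) - (f u0 x - f u0 t)) by ring.
apply Rle_lt_trans with (1 := Rabs_triang _ _).
rewrite Rabs_Ropp; lra.
Qed.

Lemma continuous_section {U : UniformSpace} (f : U -> R -> R) (u : U) (x : R) :
  continuous (fun z : U * R => f (fst z) (snd z)) (u, x) -> continuous (f u) x.
Proof.
intros H.
apply (continuous_comp_2 (fun _ : R => u) (fun y : R => y) f x).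
- apply continuous_const.
- apply continuous_id.
- exact H.
Qed.

Lemma ex_RInt_section {U : UniformSpace} (f : U -> R -> R) (a b : R) (u : U) :
  a <= b ->
  (forall x, a <= x <= b ->
    continuous (fun z : U * R => f (fst z) (snd z)) (u, x)) ->
  ex_RInt (f u) a b.
Proof.
intros Hab H; apply (ex_RInt_continuous (V := R_CompleteNormedModule)).
rewrite Rmin_left, Rmax_right by assumption.
intros x Hx; apply continuous_section, H, Hx.
Qed.

(** The parameter ranges over an arbitrary uniform space because it is later either a real number or
    a pair formed by the time and [x1]. *)
Lemma continuous_RInt_param {U : UniformSpace} (f : U -> R -> R) (a b : R) (u0 : U) :
  a <= b ->
  locally u0 (fun u => forall x, a <= x <= b ->
    continuous (fun z : U * R => f (fst z) (snd z)) (u, x)) ->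
  continuous (fun u => RInt (f u) a b) u0.
Proof.
intros Hab Hf.
assert (H0 := locally_singleton _ _ Hf).
apply filterlim_locally; intros eps.
(* The added 1 keeps the denominator positive when [a = b]. *)
assert (He : 0 < eps / (b - a + 1)) by (apply Rdiv_lt_0_compat; [apply cond_pos|lra]).
generalize (filter_and _ _ Hf (continuous_on_segment_uniform f a b u0 _ He H0)).
apply filter_imp; intros u [Hu1 Hu2].
assert (I1 := ex_RInt_section f a b u Hab Hu1).
assert (I0 := ex_RInt_section f a b u0 Hab H0).
change (Rabs (RInt (f u) a b - RInt (f u0) a b) < eps).
replace (RInt (f u) a b - RInt (f u0) a b) with (RInt (fun x => f u x - f u0 x) a b)
  by (apply (RInt_minus (f u) (f u0)); assumption).
apply Rle_lt_trans with ((b - a) * (eps / (b - a + 1))).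
- apply (norm_RInt_le_const (V := R_NormedModule) (fun x => f u x - f u0 x) a b); auto.
  + intros x Hx; left; apply Hu2, Hx.
  + apply (RInt_correct (V := R_CompleteNormedModule)), (ex_RInt_minus (V := R_NormedModule)); assumption.
- apply Rlt_le_trans with ((b - a + 1) * (eps / (b - a + 1))).
  + apply Rmult_lt_compat_r; lra.
  + right; field; lra.
Qed.

(** Heine-Borel: [w] varies by less than 1 around each centre of a finite cover, and the sum of the
    absolute values at the centres dominates each of them. *)
Lemma continuous_bounded_rectangle (w : R * R -> R) (a b c d : R) :
  (forall p, continuous w p) ->
  exists M, forall x y, a <= x <= b -> c <= y <= d -> Rabs (w (x, y)) <= M.
Proof.
intros Hw.
assert (Hd : forall t : Compactness.Tn 2 R, exists e : posreal, forall x,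
    close_n 2 e x t -> Rabs (w (fst x, fst (snd x)) - w (fst t, fst (snd t))) < 1).
{ intros [t1 [t2 []]].
  destruct (proj1 (filterlim_locally _ _) (Hw (t1, t2)) (mkposreal 1 Rlt_0_1)) as [e He].
  exists e; intros [x1 [x2 []]] [H1 [H2 _]].
  apply (He (x1, x2)); split; [exact H1|exact H2]. }
pose (delta t := proj1_sig (constructive_indefinite_description _ (Hd t))).
assert (Hdelta : forall t x, close_n 2 (delta t) x t ->
    Rabs (w (fst x, fst (snd x)) - w (fst t, fst (snd t))) < 1).
{ intros t; exact (proj2_sig (constructive_indefinite_description _ (Hd t))). }
destruct (NNPP _ (compactness_list 2 (a, (c, tt)) (b, (d, tt)) delta)) as [l Hl].
pose (bd := List.fold_right (fun t r => Rabs (w (fst t, fst (snd t))) + r) 0 l).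
assert (Hbd : forall t, List.In t l -> Rabs (w (fst t, fst (snd t))) <= bd).
{ subst bd; clear Hl; induction l as [|t0 l IH]; simpl; [tauto|].
  assert (0 <= List.fold_right (fun t r => Rabs (w (fst t, fst (snd t))) + r) 0 l).
  { clear IH; induction l as [|s l IH]; simpl; [lra|].
    generalize (Rabs_pos (w (fst s, fst (snd s)))); lra. }
  intros t [Ht|Ht].
  - rewrite Ht; lra.
  - specialize (IH t Ht); generalize (Rabs_pos (w (fst t0, fst (snd t0)))); lra. }
exists (1 + bd); intros x y Hx Hy.
destruct (Hl (x, (y, tt))) as [t [Ht1 [_ Ht2]]]; [simpl; tauto|].
specialize (Hdelta t _ Ht2); specialize (Hbd t Ht1); simpl fst in Hdelta; simpl snd in Hdelta.
generalize (Rabs_triang (w (x, y) - w (fst t, fst (snd t))) (w (fst t, fst (snd t)))).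
replace (w (x, y) - w (fst t, fst (snd t)) + w (fst t, fst (snd t))) with (w (x, y)) by ring.
lra.
Qed.

Lemma ex_RInt_of_continuous (f : R -> R) (a b : R) :
  (forall x, continuous f x) -> ex_RInt f a b.
Proof.
intros H; apply (ex_RInt_continuous (V := R_CompleteNormedModule)); auto.
Qed.

Lemma RInt_Rext (f g : R -> R) (a b : R) :
  (forall x, f x = g x) -> RInt f a b = RInt g a b.
Proof. intros H; apply RInt_ext; intros x _; apply H. Qed.

Lemma RInt_Rplus (f g : R -> R) (a b : R) : ex_RInt f a b -> ex_RInt g a b ->
  RInt (fun x => f x + g x) a b = RInt f a b + RInt g a b.
Proof. apply (RInt_plus (V := R_CompleteNormedModule)). Qed.

Lemma RInt_Rminus (f g : R -> R) (a b : R) : ex_RInt f a b -> ex_RInt g a b ->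
  RInt (fun x => f x - g x) a b = RInt f a b - RInt g a b.
Proof. apply (RInt_minus (V := R_CompleteNormedModule)). Qed.

Lemma RInt_Rmult (k : R) (f : R -> R) (a b : R) : ex_RInt f a b ->
  RInt (fun x => k * f x) a b = k * RInt f a b.
Proof. apply (RInt_scal (V := R_CompleteNormedModule)). Qed.

(** * Integration over the fundamental rectangle *)

Definition integral2 (b : R) (f : R * R -> R) : R :=
  RInt (fun x1 => RInt (fun x2 => f (x1, x2)) 0 b) 0 1.

Definition continuous2 (f : R * R -> R) : Prop := forall p, continuous f p.

Lemma continuous2_pair (f : R * R -> R) (x1 x2 : R) : continuous2 f ->
  continuous (fun z : R * R => f (fst z, snd z)) (x1, x2).
Proof.
intros Hf; apply (continuous_ext f); [intros [y1 y2]; reflexivity|apply Hf].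
Qed.

Lemma continuous2_slice (f : R * R -> R) (x1 x2 : R) : continuous2 f ->
  continuous (fun y => f (x1, y)) x2.
Proof.
intros Hf; apply (continuous_section (fun x y => f (x, y))), continuous2_pair, Hf.
Qed.

Lemma ex_RInt_inner (b : R) (f : R * R -> R) (x1 : R) : continuous2 f ->
  ex_RInt (fun x2 => f (x1, x2)) 0 b.
Proof.
intros Hf; apply (ex_RInt_continuous (V := R_CompleteNormedModule)).
intros z _; apply continuous2_slice, Hf.
Qed.

Lemma ex_RInt_outer (b : R) (f : R * R -> R) (c d : R) : 0 <= b -> continuous2 f ->
  ex_RInt (fun x1 => RInt (fun x2 => f (x1, x2)) 0 b) c d.
Proof.
intros Hb Hf; apply (ex_RInt_continuous (V := R_CompleteNormedModule)).
intros z _; apply (continuous_RInt_param (fun x1 x2 => f (x1, x2))); auto.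
apply filter_forall; intros u x _; apply continuous2_pair, Hf.
Qed.

Lemma integral2_ext (b : R) (f g : R * R -> R) :
  (forall p, f p = g p) -> integral2 b f = integral2 b g.
Proof.
intros H; unfold integral2.
apply RInt_ext; intros x _; apply RInt_ext; intros y _; apply H.
Qed.

Lemma integral2_plus (b : R) (f g : R * R -> R) : 0 <= b ->
  continuous2 f -> continuous2 g ->
  integral2 b (fun p => f p + g p) = integral2 b f + integral2 b g.
Proof.
intros Hb Hf Hg; unfold integral2.
rewrite <- RInt_Rplus by (apply ex_RInt_outer; auto).
apply RInt_ext; intros x _.
apply RInt_Rplus; apply ex_RInt_inner; assumption.
Qed.

Lemma integral2_scal (b k : R) (f : R * R -> R) : 0 <= b -> continuous2 f ->
  integral2 b (fun p => k * f p) = k * integral2 b f.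
Proof.
intros Hb Hf; unfold integral2.
rewrite <- RInt_Rmult by (apply ex_RInt_outer; auto).
apply RInt_ext; intros x _.
apply RInt_Rmult; apply ex_RInt_inner; assumption.
Qed.

Lemma integral2_le (b : R) (f g : R * R -> R) : 0 <= b ->
  continuous2 f -> continuous2 g -> (forall p, f p <= g p) ->
  integral2 b f <= integral2 b g.
Proof.
intros Hb Hf Hg H; unfold integral2.
apply RInt_le; try (apply ex_RInt_outer; auto); try lra.
intros x _; apply RInt_le; auto; apply ex_RInt_inner; assumption.
Qed.

Lemma integral2_mult (b : R) (X Y : R -> R) :
  (forall x, continuous X x) -> (forall x, continuous Y x) ->
  integral2 b (fun p => X (fst p) * Y (snd p)) = RInt X 0 1 * RInt Y 0 b.
Proof.
intros HX HY; unfold integral2; simpl.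
rewrite (RInt_ext _ (fun x => RInt Y 0 b * X x)).
- rewrite RInt_Rmult by (apply ex_RInt_of_continuous, HX).
  apply Rmult_comm.
- intros x _; rewrite RInt_Rmult by (apply ex_RInt_of_continuous, HY).
  apply Rmult_comm.
Qed.

Lemma continuous2_mult (f g : R * R -> R) :
  continuous2 f -> continuous2 g -> continuous2 (fun p => f p * g p).
Proof. intros Hf Hg p; apply (continuous_mult f g p (Hf p) (Hg p)). Qed.

Lemma continuous2_plus (f g : R * R -> R) :
  continuous2 f -> continuous2 g -> continuous2 (fun p => f p + g p).
Proof.
intros Hf Hg p; apply (continuous_plus (V := R_NormedModule) f g p (Hf p) (Hg p)).
Qed.

Lemma continuous2_scal (k : R) (f : R * R -> R) :
  continuous2 f -> continuous2 (fun p => k * f p).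
Proof. intros Hf; apply (continuous2_mult (fun _ => k)); [|exact Hf]. intros p; apply continuous_const. Qed.

Lemma continuous2_sum (f : nat -> R * R -> R) (n : nat) :
  (forall m, continuous2 (f m)) -> continuous2 (fun p => sum_f_R0 (fun m => f m p) n).
Proof.
intros Hf; induction n as [|n IH]; simpl; [apply Hf|].
apply continuous2_plus; [exact IH|apply Hf].
Qed.

Lemma integral2_sum (b : R) (f : nat -> R * R -> R) (n : nat) : 0 <= b ->
  (forall m, continuous2 (f m)) ->
  integral2 b (fun p => sum_f_R0 (fun m => f m p) n) =
  sum_f_R0 (fun m => integral2 b (f m)) n.
Proof.
intros Hb Hf; induction n as [|n IH]; simpl; [reflexivity|].
rewrite integral2_plus, IH; auto.
apply continuous2_sum; exact Hf.
Qed.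

Lemma continuous2_of_fst (X : R -> R) : (forall x, continuous X x) ->
  continuous2 (fun p => X (fst p)).
Proof. intros H [x y]; apply continuous_comp; [apply continuous_fst|apply H]. Qed.

Lemma continuous2_of_snd (X : R -> R) : (forall x, continuous X x) ->
  continuous2 (fun p => X (snd p)).
Proof. intros H [x y]; apply continuous_comp; [apply continuous_snd|apply H]. Qed.

(** * Green's identity on the Klein bottle *)

(** The hypotheses are local in the parameter because the heat kernel is controlled at positive
    times only. *)
Lemma is_derive_RInt_continuous (f df : R -> R -> R) (a b x : R) :
  a <= b ->
  locally x (fun u => forall t, is_derive (fun z => f z t) u (df u t)) ->
  locally x (fun u => forall t,
    continuous (fun z : R * R => df (fst z) (snd z)) (u, t)) ->
  locally x (fun u => forall t, continuous (f u) t) ->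
  is_derive (fun u => RInt (f u) a b) x (RInt (df x) a b).
Proof.
intros Hab Hd Hc Hf.
rewrite (RInt_Rext (df x) (fun t => Derive (fun u => f u t) x)).
- apply (is_derive_RInt_param (fun u t => f u t)).
  + revert Hd; apply filter_imp; intros u Hu t _.
    exists (df u t); apply Hu.
  + intros t _; apply continuity_2d_pt_filterlim.
    generalize (locally_singleton _ _ Hc t); unfold continuous; simpl; intros Hct.
    replace (Derive (fun z => f z t) x) with (df x t)
      by (symmetry; apply is_derive_unique, (locally_singleton _ _ Hd)).
    revert Hct; apply filterlim_ext_loc.
    destruct Hd as [e He]; exists e; intros [u s] [Hu _]; simpl.
    symmetry; apply is_derive_unique, He, Hu.
  + revert Hf; apply filter_imp; intros u Hu.
    apply (ex_RInt_continuous (V := R_CompleteNormedModule)); intros z _; apply Hu.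
- intros t; symmetry; apply is_derive_unique, (locally_singleton _ _ Hd).
Qed.

Lemma is_derive_RInt_partial1 (v : R * R -> R) (Y : R -> R) (b x : R) :
  0 <= b -> (forall p, ex_derive (fun r => v (r, snd p)) (fst p)) ->
  continuous2 v -> continuous2 (partial1 v) -> (forall y, continuous Y y) ->
  is_derive (fun x1 => RInt (fun x2 => v (x1, x2) * Y x2) 0 b) x
    (RInt (fun x2 => partial1 v (x, x2) * Y x2) 0 b).
Proof.
intros Hb Hd Hv Hv' HY.
apply (is_derive_RInt_continuous (fun x1 x2 => v (x1, x2) * Y x2)
  (fun x1 x2 => partial1 v (x1, x2) * Y x2)); [exact Hb| | |];
  apply filter_forall; intros u t.
- apply (is_derive_ext (fun z => Y t * v (z, t))); [intros; apply Rmult_comm|].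
  rewrite Rmult_comm; apply (is_derive_scal (fun z => v (z, t))).
  apply Derive_correct, (Hd (u, t)).
- apply (continuous_mult (fun z : R * R => partial1 v (fst z, snd z)) (fun z => Y (snd z))).
  + apply continuous2_pair, Hv'.
  + apply continuous_comp; [apply continuous_snd|apply HY].
- apply (continuous_mult (fun y => v (u, y)) Y); [apply continuous2_slice, Hv|apply HY].
Qed.

Definition klein_invariant (b : R) (v : R * R -> R) : Prop :=
  (forall x1 x2, v (1 + x1, x2) = v (x1, x2)) /\
  (forall x1 x2, v (1 - x1, b + x2) = v (x1, x2)).

Lemma continuous_of_is_derive (f f' : R -> R) :
  (forall x, is_derive f x (f' x)) -> forall x, continuous f x.
Proof.
intros H x; apply (ex_derive_continuous (V := R_NormedModule)); exists (f' x); apply H.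
Qed.

Lemma continuous_scal_R (k : R) (f : R -> R) (x : R) :
  continuous f x -> continuous (fun y => k * f y) x.
Proof. intros H; apply (continuous_mult (fun _ => k) f); [apply continuous_const|exact H]. Qed.

(** The Wronskian [f1 * g - f * g1] has derivative [f2 * g + k * (f * g)]. *)
Lemma RInt_by_parts_twice (f f1 f2 g g1 : R -> R) (k c d : R) :
  (forall x, is_derive f x (f1 x)) -> (forall x, is_derive f1 x (f2 x)) ->
  (forall x, continuous f2 x) ->
  (forall x, is_derive g x (g1 x)) -> (forall x, is_derive g1 x (- k * g x)) ->
  RInt (fun x => f2 x * g x) c d =
    (f1 d * g d - f d * g1 d) - (f1 c * g c - f c * g1 c)
    - k * RInt (fun x => f x * g x) c d.
Proof.
intros Hf Hf1 Hf2 Hg Hg1.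
assert (Cf := continuous_of_is_derive _ _ Hf).
assert (Cg := continuous_of_is_derive _ _ Hg).
assert (Cfg : forall x, continuous (fun x => f x * g x) x)
  by (intros; apply (continuous_mult f g); auto).
assert (Cf2g : forall x, continuous (fun x => f2 x * g x) x)
  by (intros; apply (continuous_mult f2 g); auto).
assert (H : is_RInt (fun x => f2 x * g x + k * (f x * g x)) c d
    ((f1 d * g d - f d * g1 d) - (f1 c * g c - f c * g1 c))).
{ apply (is_RInt_derive (V := R_CompleteNormedModule)
    (fun x => f1 x * g x - f x * g1 x)).
  - intros x _.
    replace (f2 x * g x + k * (f x * g x)) with
      ((f2 x * g x + f1 x * g1 x) - (f1 x * g1 x + f x * (- k * g x))) by ring.
    apply (is_derive_minus (V := R_NormedModule)
      (fun x => f1 x * g x) (fun x => f x * g1 x));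
      apply (is_derive_mult (K := R_AbsRing)); auto; intros; apply Rmult_comm.
  - intros x _; apply (continuous_plus (V := R_NormedModule)
      (fun x => f2 x * g x) (fun x => k * (f x * g x))); [apply Cf2g|].
    apply continuous_scal_R, Cfg. }
apply (is_RInt_unique (V := R_CompleteNormedModule)) in H; rewrite <- H.
rewrite (RInt_Rplus (fun x => f2 x * g x) (fun x => k * (f x * g x))).
- rewrite RInt_Rmult by (apply ex_RInt_of_continuous, Cfg).
  lra.
- apply ex_RInt_of_continuous, Cf2g.
- apply ex_RInt_of_continuous; intros; apply continuous_scal_R, Cfg.
Qed.

Lemma RInt_reflect (f : R -> R) : (forall x, continuous f x) ->
  RInt (fun x => f (1 - x)) 0 1 = RInt f 0 1.
Proof.
intros Hf.
assert (E : forall c d, ex_RInt f c d) by (intros; apply ex_RInt_of_continuous, Hf).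
assert (Er : ex_RInt (fun x => f (1 - x)) 0 1).
{ apply ex_RInt_of_continuous; intros z.
  apply (continuous_comp (fun y => 1 - y) f); [|apply Hf].
  apply (ex_derive_continuous (V := R_NormedModule)); auto_derive; auto. }
generalize (RInt_comp_lin (V := R_CompleteNormedModule) f (-1) 1 0 1 (E _ _)).
replace (-1 * 0 + 1) with 1 by ring; replace (-1 * 1 + 1) with 0 by ring.
rewrite <- (opp_RInt_swap (V := R_CompleteNormedModule) f 1 0) by apply E.
rewrite (RInt_Rext _ (fun x => -1 * f (1 - x))).
- rewrite RInt_Rmult by exact Er.
  intros H; change (RInt (fun x => f (1 - x)) 0 1 = - RInt f 1 0); lra.
- intros x; replace (1 - x) with (-1 * x + 1) by ring; reflexivity.
Qed.

Lemma Derive_shift (f : R -> R) (k x : R) : ex_derive f (k + x) ->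
  Derive (fun r => f (k + r)) x = Derive f (k + x).
Proof.
intros Hf; rewrite (Derive_comp f (fun r => k + r)); [|exact Hf|auto_derive; auto].
rewrite <- (Rmult_1_l (Derive f (k + x))) at 2; f_equal.
apply is_derive_unique; auto_derive; auto; ring.
Qed.

(** [sg] is the sign picked up by each factor of [X(x1) Y(x2)] under the glide
    reflection; the Neumann conditions on [Y] make the boundary terms cancel. *)
Record klein_mode (b mu nu sg : R) (X X' Y Y' : R -> R) : Prop := {
  mode_X : forall x, is_derive X x (X' x);
  mode_X' : forall x, is_derive X' x (- mu * X x);
  mode_X_period : X 1 = X 0;
  mode_X'_period : X' 1 = X' 0;
  mode_X_reflect : forall x, X (1 - x) = sg * X x;
  mode_Y : forall x, is_derive Y x (Y' x);
  mode_Y' : forall x, is_derive Y' x (- nu * Y x);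
  mode_Y0 : Y 0 = 1;
  mode_Yb : Y b = sg;
  mode_Y'0 : Y' 0 = 0;
  mode_Y'b : Y' b = 0 }.

(** In [x1] the boundary terms agree by translation. In [x2] the side at height [b] is glued to the
    side at height 0 after a reflection, so these boundary terms cancel only once integrated over
    [x1]. *)
Lemma green_klein (b mu nu sg : R) (X X' Y Y' : R -> R) (v : R * R -> R) :
  0 <= b -> klein_mode b mu nu sg X X' Y Y' -> klein_invariant b v ->
  ex_partials v -> ex_partials (partial1 v) -> ex_partials (partial2 v) ->
  continuous2 v -> continuous2 (partial1 v) -> continuous2 (partial2 v) ->
  continuous2 (partial1 (partial1 v)) -> continuous2 (partial2 (partial2 v)) ->
  integral2 b (fun p => laplacian v p * (X (fst p) * Y (snd p))) =
  - (mu + nu) * integral2 b (fun p => v p * (X (fst p) * Y (snd p))).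
Proof.
intros Hb [HX HX' X1 X1' Xr HY HY' Y0 Yb Y0' Yb'] [Hi1 Hi2] Ev Ev1 Ev2 Cv Cv1 Cv2 Cv11 Cv22.
assert (CX := continuous_of_is_derive _ _ HX).
assert (CY := continuous_of_is_derive _ _ HY).
assert (Cphi : continuous2 (fun p => X (fst p) * Y (snd p))).
{ apply (continuous2_mult (fun p => X (fst p)) (fun p => Y (snd p))).
  - apply continuous2_of_fst, CX.
  - apply continuous2_of_snd, CY. }
rewrite (integral2_ext b _ (fun p => partial1 (partial1 v) p * (X (fst p) * Y (snd p)) +
  partial2 (partial2 v) p * (X (fst p) * Y (snd p))))
  by (intros; unfold laplacian; ring).
rewrite integral2_plus; try apply continuous2_mult; auto.
assert (I1 : integral2 b (fun p => partial1 (partial1 v) p * (X (fst p) * Y (snd p))) =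
  - mu * integral2 b (fun p => v p * (X (fst p) * Y (snd p)))).
(* Integrating over [x2] first leaves functions of [x1] alone, to which integration by parts applies
   without exchanging the integrals. *)
{ assert (E : forall f, continuous2 f ->
      integral2 b (fun p => f p * (X (fst p) * Y (snd p))) =
      RInt (fun x1 => RInt (fun x2 => f (x1, x2) * Y x2) 0 b * X x1) 0 1).
  { intros f Cf; unfold integral2; apply RInt_Rext; intros x1; simpl.
    rewrite (RInt_Rext _ (fun x2 => X x1 * (f (x1, x2) * Y x2))) by (intros; ring).
    rewrite RInt_Rmult.
    - apply Rmult_comm.
    - apply (ex_RInt_inner b (fun p => f p * Y (snd p))).
      apply continuous2_mult; [exact Cf|apply continuous2_of_snd, CY]. }
  rewrite !E by assumption.
  rewrite (RInt_by_parts_twice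
    (fun x1 => RInt (fun x2 => v (x1, x2) * Y x2) 0 b)
    (fun x1 => RInt (fun x2 => partial1 v (x1, x2) * Y x2) 0 b)
    (fun x1 => RInt (fun x2 => partial1 (partial1 v) (x1, x2) * Y x2) 0 b) X X' mu); auto.
  - rewrite X1, X1'.
    rewrite (RInt_Rext (fun x2 => v (1, x2) * Y x2) (fun x2 => v (0, x2) * Y x2)).
    rewrite (RInt_Rext (fun x2 => partial1 v (1, x2) * Y x2)
      (fun x2 => partial1 v (0, x2) * Y x2)).
    + ring.
    + intros x2; f_equal; unfold partial1; simpl.
      replace 1 with (1 + 0) by ring.
      rewrite <- (Derive_shift (fun r => v (r, x2)) 1 0 (proj1 (Ev (1 + 0, x2)))).
      apply Derive_ext; intros; apply Hi1.
    + intros x2; f_equal; rewrite <- (Hi1 0); f_equal; f_equal; ring.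
  - intros x; apply is_derive_RInt_partial1; auto; intros p; apply Ev.
  - intros x; apply is_derive_RInt_partial1; auto; intros p; apply Ev1.
  - intros x; apply (continuous_RInt_param
      (fun x1 x2 => partial1 (partial1 v) (x1, x2) * Y x2)); [exact Hb|].
    apply filter_forall; intros u t _.
    apply (continuous_mult (fun z : R * R => partial1 (partial1 v) (fst z, snd z))
      (fun z => Y (snd z))).
    + apply continuous2_pair, Cv11.
    + apply continuous_comp; [apply continuous_snd|apply CY]. }
assert (I2 : integral2 b (fun p => partial2 (partial2 v) p * (X (fst p) * Y (snd p))) =
  - nu * integral2 b (fun p => v p * (X (fst p) * Y (snd p)))).
(* [Y'] vanishes at both ends, so only the terms in [partial2 v] remain; the glide reflection
   carries the one at height [b] to height 0, above [1 - x1]. *)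
{ assert (Hin : forall x1,
    RInt (fun x2 => partial2 (partial2 v) (x1, x2) * (X x1 * Y x2)) 0 b =
    (sg * X x1 * partial2 v (1 - x1, 0) - X x1 * partial2 v (x1, 0)) +
    - nu * RInt (fun x2 => v (x1, x2) * (X x1 * Y x2)) 0 b :> R).
  { intros x1.
    rewrite (RInt_by_parts_twice (fun x2 => v (x1, x2)) (fun x2 => partial2 v (x1, x2))
      (fun x2 => partial2 (partial2 v) (x1, x2)) (fun x2 => X x1 * Y x2)
      (fun x2 => X x1 * Y' x2) nu).
    - rewrite Y0, Yb, Y0', Yb'.
      replace (partial2 v (x1, b)) with (partial2 v (1 - x1, 0)); [ring|].
      unfold partial2; simpl.
      replace b with (b + 0) by ring.
      rewrite <- (Derive_shift (fun r => v (x1, r)) b 0 (proj2 (Ev (x1, b + 0)))).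
      apply Derive_ext; intros r.
      rewrite <- (Hi2 (1 - x1) r); f_equal; f_equal; ring.
    - intros x; apply Derive_correct, (Ev (x1, x)).
    - intros x; apply Derive_correct, (Ev2 (x1, x)).
    - intros x; apply continuous2_slice, Cv22.
    - intros x; apply (is_derive_scal Y), HY.
    - intros x; replace (- nu * (X x1 * Y x)) with (X x1 * (- nu * Y x)) by ring.
      apply (is_derive_scal Y'), HY'. }
  assert (C1 : forall g : R -> R, (forall x, continuous g x) ->
     forall x, continuous (fun x => g x * partial2 v (x, 0)) x).
  { intros g Cg x.
    apply (continuous_mult g (fun x => partial2 v (x, 0))); [apply Cg|].
    apply (continuous_comp_2 (fun x : R => x) (fun _ : R => 0)
      (fun x1 x2 => partial2 v (x1, x2))).
    + apply continuous_id.
    + apply continuous_const.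
    + apply continuous2_pair, Cv2. }
  assert (C2 : forall x, continuous (fun x => sg * X x * partial2 v (1 - x, 0)) x).
  { intros x.
    apply (continuous_ext (fun x => X (1 - x) * partial2 v (1 - x, 0))).
    - intros y; rewrite Xr; reflexivity.
    - apply (continuous_comp (fun y => 1 - y) (fun y => X y * partial2 v (y, 0))).
      + apply (ex_derive_continuous (V := R_NormedModule)); auto_derive; auto.
      + apply C1, CX. }
  unfold integral2; simpl.
  rewrite (RInt_Rext _ (fun x1 =>
    sg * X x1 * partial2 v (1 - x1, 0) - X x1 * partial2 v (x1, 0) +
    - nu * RInt (fun x2 => v (x1, x2) * (X x1 * Y x2)) 0 b)) by (intros; apply Hin).
  assert (Co := ex_RInt_outer b (fun p => v p * (X (fst p) * Y (snd p))) 0 1 Hb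
    (continuous2_mult _ _ Cv Cphi)); simpl in Co.
  rewrite RInt_Rplus.
  - rewrite RInt_Rminus.
    (* The two boundary terms are exchanged by [x1 -> 1 - x1], hence have the same integral. *)
    + rewrite (RInt_Rext (fun x1 => sg * X x1 * partial2 v (1 - x1, 0))
        (fun x1 => X (1 - x1) * partial2 v (1 - x1, 0)))
        by (intros; rewrite Xr; reflexivity).
      rewrite (RInt_reflect (fun x1 => X x1 * partial2 v (x1, 0)))
        by (apply C1, CX).
      rewrite RInt_Rmult by exact Co; lra.
    + apply ex_RInt_of_continuous; intros; apply C2.
    + apply ex_RInt_of_continuous; intros; apply C1, CX.
  - apply (ex_RInt_minus (V := R_NormedModule)).
    + apply ex_RInt_of_continuous; intros; apply C2.
    + apply ex_RInt_of_continuous; intros; apply C1, CX.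
  - apply (ex_RInt_scal (V := R_NormedModule)), Co. }
rewrite I1, I2; ring.
Qed.

(** * Fourier coefficients of the heat kernel *)

Lemma proj_eq (b : R) (p q : R * R) : klein_eq b p q -> proj b p = proj b q.
Proof.
intros H; unfold proj.
assert (E : klein_eq b p = klein_eq b q).
{ apply functional_extensionality; intros r; apply propositional_extensionality.
  split; intros Hr.
  - apply rst_trans with p; [apply rst_sym, H|exact Hr].
  - apply rst_trans with q; [exact H|exact Hr]. }
apply subset_eq_compat, E.
Qed.

Lemma proj_inv (b : R) (p q : R * R) : proj b p = proj b q -> klein_eq b p q.
Proof.
intros H; apply (f_equal (@proj1_sig _ _)) in H; simpl in H.
rewrite H; apply rst_refl.
Qed.

Lemma klein_invariant_proj (b : R) (F : klein b -> R) :
  klein_invariant b (fun p => F (proj b p)).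
Proof.
split; intros x1 x2; f_equal; apply proj_eq, rst_sym, rst_step; [left|right]; reflexivity.
Qed.

Lemma klein_invariant_eq (b : R) (v : R * R -> R) (p q : R * R) :
  klein_invariant b v -> klein_eq b p q -> v p = v q.
Proof.
intros [H1 H2] H; induction H as [p q [-> | ->]|p|p q _ IH|p q r _ IH1 _ IH2].
- rewrite H1; destruct p; reflexivity.
- rewrite H2; destruct p; reflexivity.
- reflexivity.
- symmetry; exact IH.
- rewrite IH1; exact IH2.
Qed.

(** The Dirac condition is tested on functions of the quotient; choice of a representative in each
    class makes an invariant function descend. *)
Lemma klein_invariant_factor (b : R) (v : R * R -> R) : klein_invariant b v ->
  exists f : klein b -> R, forall p, f (proj b p) = v p.
Proof.
intros Hv.
exists (fun k : klein b =>
  v (proj1_sig (constructive_indefinite_description _ (proj2_sig k)))).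
intros p; destruct constructive_indefinite_description as [q Hq]; simpl in *.
symmetry; apply (klein_invariant_eq b); [exact Hv|].
rewrite Hq; apply rst_refl.
Qed.

Lemma continuous_pairing {U V W : UniformSpace} (f : U -> V) (g : U -> W) (x : U) :
  continuous f x -> continuous g x -> continuous (fun u => (f u, g u)) x.
Proof.
intros Hf Hg.
apply (continuous_comp_2 f g (fun v w => (v, w))); [exact Hf|exact Hg|].
apply (continuous_ext (fun z => z)); [intros [v w]; reflexivity|apply continuous_id].
Qed.

Lemma is_derive_integral2_time (b : R) (u : R -> R * R -> R) (phi : R * R -> R) (t : R) :
  0 <= b -> C12 u -> continuous2 phi -> 0 < t ->
  is_derive (fun r => integral2 b (fun p => u r p * phi p)) t
    (integral2 b (fun p => time_partial u t p * phi p)).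
Proof.
intros Hb [Ht [_ [Cu [Cut _]]]] Cphi Htp.
assert (Hpos : locally t (fun s => 0 < s)) by (apply open_gt, Htp).
(* Reassociated so that the time and [x1] form the parameter and [x2] is the integration
   variable. *)
assert (Assoc : forall w : R -> R * R -> R, continuous_pos_time w ->
    forall s x1 x2, 0 < s ->
    continuous (fun z : (R * R) * R => w (fst (fst z)) (snd (fst z), snd z) *
      phi (snd (fst z), snd z)) ((s, x1), x2)).
{ intros w Hw s x1 x2 Hs.
  assert (Cp : continuous (fun z : (R * R) * R => (snd (fst z), snd z)) ((s, x1), x2)).
  { apply (continuous_pairing (fun z : (R * R) * R => snd (fst z)) snd).
    - apply (continuous_comp fst snd); [apply continuous_fst|apply continuous_snd].
    - apply continuous_snd. }
  apply (continuous_mult (fun z : (R * R) * R => w (fst (fst z)) (snd (fst z), snd z))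
    (fun z : (R * R) * R => phi (snd (fst z), snd z))).
  - apply (continuous_comp_2 (fun z : (R * R) * R => fst (fst z))
      (fun z : (R * R) * R => (snd (fst z), snd z)) w).
    + apply (continuous_comp fst fst); [apply continuous_fst|apply continuous_fst].
    + exact Cp.
    + apply (Hw s (x1, x2) Hs).
  - apply (continuous_comp (fun z : (R * R) * R => (snd (fst z), snd z)) phi);
      [exact Cp|apply Cphi]. }
assert (Slice : forall w : R -> R * R -> R, continuous_pos_time w ->
    forall s, 0 < s -> continuous2 (fun p => w s p * phi p)).
{ intros w Hw s Hs; apply (continuous2_mult (w s)); [|exact Cphi]; intros p.
  apply (continuous_comp_2 (fun _ : R * R => s) (fun p => p) w).
  - apply continuous_const.
  - apply continuous_id.
  - apply (Hw s p Hs). }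
assert (Joint : forall w : R -> R * R -> R, continuous_pos_time w ->
    forall s x1, 0 < s ->
    continuous (fun z : R * R =>
      RInt (fun x2 => w (fst z) (snd z, x2) * phi (snd z, x2)) 0 b) (s, x1)).
{ intros w Hw s x1 Hs.
  apply (continuous_RInt_param (fun (z : R * R) x2 =>
    w (fst z) (snd z, x2) * phi (snd z, x2)) 0 b (s, x1)); [exact Hb|].
  assert (Hpos' : locally (s, x1) (fun z : R * R => 0 < fst z)).
  { destruct (open_gt 0 s Hs) as [e He].
    exists e; intros [s' y] [Hs' _]; apply He, Hs'. }
  revert Hpos'; apply filter_imp; intros [s' y] Hs' x _; apply (Assoc w Hw), Hs'. }
unfold integral2.
apply (is_derive_RInt_continuous
  (fun s x1 => RInt (fun x2 => u s (x1, x2) * phi (x1, x2)) 0 b)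
  (fun s x1 => RInt (fun x2 => time_partial u s (x1, x2) * phi (x1, x2)) 0 b)); [lra| | |];
  revert Hpos; apply filter_imp; intros s Hs x1.
- assert (Hpos : locally s (fun s => 0 < s)) by (apply open_gt, Hs).
  assert (Pair : forall w : R -> R * R -> R, continuous_pos_time w ->
    forall r x2, 0 < r ->
    continuous (fun z : R * R => w (fst z) (x1, snd z) * phi (x1, snd z)) (r, x2)).
  { intros w Hw r x2 Hr.
    apply (continuous_comp (fun z : R * R => ((fst z, x1), snd z))
      (fun z : (R * R) * R => w (fst (fst z)) (snd (fst z), snd z) *
        phi (snd (fst z), snd z))).
    - apply (continuous_pairing (fun z : R * R => (fst z, x1)) snd); [|apply continuous_snd].
      apply (continuous_pairing fst (fun _ => x1)); [apply continuous_fst|apply continuous_const].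
    - apply (Assoc w Hw), Hr. }
  apply (is_derive_RInt_continuous (fun s x2 => u s (x1, x2) * phi (x1, x2))
    (fun s x2 => time_partial u s (x1, x2) * phi (x1, x2))); [exact Hb| | |];
    revert Hpos; apply filter_imp; intros r Hr x2.
  + apply (is_derive_ext (fun z => phi (x1, x2) * u z (x1, x2))); [intros; apply Rmult_comm|].
    rewrite Rmult_comm; apply (is_derive_scal (fun z => u z (x1, x2))).
    apply Derive_correct, Ht, Hr.
  + apply Pair; assumption.
  + apply (continuous2_slice (fun p => u r p * phi p)), Slice; assumption.
- apply Joint; assumption.
- apply (continuous_section (fun s x1 => RInt (fun x2 => u s (x1, x2) * phi (x1, x2)) 0 b)).
  apply Joint; assumption.
Qed.

(* [a(t) exp(lambda t)] is constant on positive times, so its value is the limit at 0. *)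
Lemma exponential_decay (a : R -> R) (lambda l : R) :
  (forall t, 0 < t -> is_derive a t (- lambda * a t)) ->
  filterlim a (at_right 0) (locally l) ->
  forall t, 0 < t -> a t = exp (- lambda * t) * l.
Proof.
intros Ha Hl t Ht.
pose (g s := exp (lambda * s) * a s).
assert (Hg : forall s, 0 < s -> is_derive g s 0).
{ intros s Hs; unfold g.
  replace 0 with (lambda * exp (lambda * s) * a s + exp (lambda * s) * (- lambda * a s)) by ring.
  apply (is_derive_mult (K := R_AbsRing) (fun s => exp (lambda * s)) a).
  - auto_derive; auto; ring.
  - apply Ha, Hs.
  - intros; apply Rmult_comm. }
assert (Hc : forall s, 0 < s -> s < t -> g s = g t).
{ intros s Hs Hst; apply (eq_is_derive (V := R_NormedModule) g); [|exact Hst].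
  intros r Hr; apply Hg; lra. }
assert (L1 : filterlim g (at_right 0) (locally (exp (lambda * 0) * l))).
{ unfold g; apply (filterlim_comp_2 (F := at_right 0) (G := locally (exp (lambda * 0)))
    (H := locally l) (fun s => exp (lambda * s)) a Rmult).
  - apply (filterlim_filter_le_1 _ (filter_le_within (F := locally 0) _)).
    apply (ex_derive_continuous (V := R_NormedModule) (fun s => exp (lambda * s)));
      auto_derive; auto.
  - exact Hl.
  - apply (filterlim_mult (K := R_AbsRing)). }
assert (L2 : filterlim g (at_right 0) (locally (g t))).
{ apply (filterlim_ext_loc (fun _ => g t)); [|apply filterlim_const].
  exists (mkposreal t Ht); intros s Hs Hs0; symmetry; apply Hc; [exact Hs0|].
  unfold ball in Hs; simpl in Hs; unfold AbsRing_ball, abs, minus, plus, opp in Hs; simpl in Hs.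
  apply Rabs_def2 in Hs; lra. }
assert (E := filterlim_locally_unique (F := at_right 0) g _ _ L2 L1).
rewrite Rmult_0_r, exp_0, Rmult_1_l in E.
rewrite <- E; unfold g; rewrite <- Rmult_assoc, <- exp_plus.
replace (- lambda * t + lambda * t) with 0 by ring; rewrite exp_0; ring.
Qed.

Lemma heat_kernel_mode (b : R) (K : R -> klein b -> klein b -> R)
    (mu nu sg : R) (X X' Y Y' : R -> R) (t : R) (q : R * R) :
  0 < b -> is_heat_kernel b K -> klein_mode b mu nu sg X X' Y Y' ->
  klein_invariant b (fun p => X (fst p) * Y (snd p)) -> 0 < t ->
  integral2 b (fun p => K t (proj b p) (proj b q) * (X (fst p) * Y (snd p))) =
  exp (- (mu + nu) * t) * (X (fst q) * Y (snd q)).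
Proof.
intros Hb [_ [HC [Hheat Hdirac]]] Hm Hinv Ht.
assert (CX := continuous_of_is_derive _ _ (mode_X _ _ _ _ _ _ _ _ Hm)).
assert (CY := continuous_of_is_derive _ _ (mode_Y _ _ _ _ _ _ _ _ Hm)).
assert (Cphi : continuous2 (fun p => X (fst p) * Y (snd p))).
{ apply (continuous2_mult (fun p => X (fst p)) (fun p => Y (snd p))).
  - apply continuous2_of_fst, CX.
  - apply continuous2_of_snd, CY. }
pose (u := fun t p => K t (proj b p) (proj b q)).
apply (exponential_decay (fun t => integral2 b (fun p => u t p * (X (fst p) * Y (snd p)))));
  [| |exact Ht].
- intros s Hs.
  assert (HCu := HC (proj b q)); fold u in HCu.
  (* Green's identity, read from right to left, produces the integral of the Laplacian, which the
     heat equation turns into that of the time derivative. *)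
  rewrite <- (green_klein b mu nu sg X X' Y Y' (u s)); auto; try lra;
    try (apply (klein_invariant_proj b (fun k => K s k (proj b q))));
    try (destruct HCu as (_ & E & C & _ & C1 & C2 & C11 & _ & _ & C22);
         solve [apply (E s Hs) | 
         let H := fresh in
         assert (H : forall w : R -> R * R -> R, continuous_pos_time w -> continuous2 (w s));
         [intros w Hw p; apply (continuous_comp_2 (fun _ : R * R => s) (fun p => p) w);
           [apply continuous_const|apply continuous_id|apply (Hw s p Hs)]|
         first [apply (H u C)|apply (H _ C1)|apply (H _ C2)|apply (H _ C11)|apply (H _ C22)]]]).
  rewrite <- (integral2_ext b (fun p => time_partial u s p * (X (fst p) * Y (snd p)))).
  + apply is_derive_integral2_time; auto; lra.
  + intros p; f_equal; apply (Hheat s p (proj b q) Hs).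
(* Initial value: the mode descends to a continuous function on the Klein bottle, an admissible test
   function for the Dirac condition. *)
- destruct (klein_invariant_factor b _ Hinv) as [f Hf].
  rewrite <- Hf.
  replace (proj b (fst q, snd q)) with (proj b q) by (destruct q; reflexivity).
  apply (filterlim_ext (fun t => klein_integral b (fun x => K t x (proj b q) * f x))).
  + intros s; unfold klein_integral, integral2.
    apply RInt_Rext; intros x1; apply RInt_Rext; intros x2; rewrite Hf; reflexivity.
  + apply Hdirac; intros p.
    apply (continuous_ext (fun p => X (fst p) * Y (snd p))); [intros; symmetry; apply Hf|].
    apply Cphi.
Qed.

(** * Fejer kernels *)

(** Weights of the Fejer kernel in real form: the factor 2 accounts for the frequencies [m] and
    [- m] together. *)
Definition fejer_coef (N m : nat) : R :=
  match m with O => 1 | _ => 2 * (1 - INR m / (INR N + 1)) end.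

Definition fejer (N : nat) (th : R) : R :=
  sum_f_R0 (fun m => fejer_coef N m * cos (INR m * th)) N.

Lemma fejer_coef_bound (N m : nat) : (m <= N)%nat -> 0 <= fejer_coef N m <= 2.
Proof.
intros H; apply le_INR in H; destruct m as [|m]; simpl fejer_coef; [lra|].
assert (HN := pos_INR N).
assert (0 <= INR (S m) / (INR N + 1) <= 1); [|simpl INR in *; lra].
split; [apply Rdiv_le_0_compat; [apply pos_INR|lra]|].
apply Rle_div_l; lra.
Qed.

Lemma fejer_mult (N : nat) (th : R) :
  (1 - cos th) * fejer N th = (1 - cos (INR (S N) * th)) / (INR N + 1).
Proof.
assert (HN := pos_INR N).
(* Closed form of the partial sums, from the recurrence [cos((j+2) th) = 2 cos th cos((j+1) th) -
   cos(j th)]. At [j = N] the middle term vanishes and the last cosine has coefficient 1. *)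
assert (H : forall j, (1 - cos th) *
    sum_f_R0 (fun m => fejer_coef N m * cos (INR m * th)) j * (INR N + 1) =
    1 + (INR N - INR j) * cos (INR j * th) - (INR N + 1 - INR j) * cos (INR (S j) * th)).
{ intros j; induction j as [|j IH].
  - simpl; rewrite Rmult_0_l, cos_0, !Rmult_1_l; ring.
  - rewrite tech5, (Rmult_plus_distr_l (1 - cos th)), Rmult_plus_distr_r, IH.
    unfold fejer_coef.
    replace (2 * (1 - INR (S j) / (INR N + 1)) * cos (INR (S j) * th)) with
      (2 * (INR N + 1 - INR (S j)) / (INR N + 1) * cos (INR (S j) * th)) by (field; lra).
    replace (cos (INR (S (S j)) * th)) with
      (2 * cos th * cos (INR (S j) * th) - cos (INR j * th)).
    + rewrite !S_INR; field; lra.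
    + replace (INR (S (S j)) * th) with (INR (S j) * th + th) by (rewrite !S_INR; ring).
      replace (INR j * th) with (INR (S j) * th - th) by (rewrite !S_INR; ring).
      rewrite cos_plus, cos_minus; ring. }
specialize (H N); fold (fejer N th) in H.
apply (Rmult_eq_reg_r (INR N + 1)); [|lra].
rewrite H; field; lra.
Qed.

(** Divide [fejer_mult] by [1 - cos th]; where this factor vanishes every cosine of the sum equals 1
    and the weights are nonnegative. *)
Lemma fejer_nonneg (N : nat) (th : R) : 0 <= fejer N th.
Proof.
assert (HN := pos_INR N).
destruct (Req_dec (cos th) 1) as [E|E].
- assert (Es : sin th = 0).
  { generalize (sin2_cos2 th); rewrite E; unfold Rsqr; intros H; apply Rsqr_0_uniq; unfold Rsqr; lra. }
  assert (Hc : forall m, cos (INR m * th) = 1).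
  { intros m; induction m as [|m IH]; [simpl; rewrite Rmult_0_l; apply cos_0|].
    rewrite S_INR, Rmult_plus_distr_r, Rmult_1_l, cos_plus, IH, E, Es; ring. }
  unfold fejer; rewrite (sum_eq _ (fun m => fejer_coef N m * 1))
    by (intros; rewrite Hc; reflexivity).
  rewrite <- (Rmult_0_l 0).
  apply Rle_trans with (sum_f_R0 (fun _ => 0) N).
  + rewrite sum_cte; lra.
  + apply sum_Rle; intros m Hm; generalize (fejer_coef_bound N m Hm); lra.
- assert (Hp : 0 < 1 - cos th) by (generalize (COS_bound th); lra).
  apply (Rmult_le_reg_l _ _ _ Hp); rewrite Rmult_0_r, fejer_mult.
  apply Rdiv_le_0_compat; [generalize (COS_bound (INR (S N) * th))|]; lra.
Qed.

Lemma continuous_sum (f : nat -> R -> R) (n : nat) (x : R) :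
  (forall m, continuous (f m) x) -> continuous (fun y => sum_f_R0 (fun m => f m y) n) x.
Proof.
intros Hf; induction n as [|n IH]; simpl; [apply Hf|].
apply (continuous_plus (V := R_NormedModule) (fun y => sum_f_R0 (fun m => f m y) n));
  [exact IH|apply Hf].
Qed.

Lemma RInt_Rsum (f : nat -> R -> R) (n : nat) (c d : R) :
  (forall m x, continuous (f m) x) ->
  RInt (fun y => sum_f_R0 (fun m => f m y) n) c d = sum_f_R0 (fun m => RInt (f m) c d) n.
Proof.
intros Hf; induction n as [|n IH]; simpl; [reflexivity|].
rewrite RInt_Rplus, IH; [reflexivity| |];
  apply ex_RInt_of_continuous; intros x; [apply continuous_sum|]; auto.
Qed.

Lemma continuous_cos_affine (k p q x : R) : continuous (fun x => cos (k * (p * x + q))) x.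
Proof. apply (ex_derive_continuous (V := R_NormedModule)); auto_derive; auto. Qed.

Lemma continuous_fejer (N : nat) (p q x : R) : continuous (fun x => fejer N (p * x + q)) x.
Proof.
unfold fejer; apply continuous_sum; intros m.
apply continuous_scal_R, continuous_cos_affine.
Qed.

(** [x |-> p * x + q] maps [[c, d]] onto an interval over which [cos (m x)] has
    mean zero for every integer [m > 0]. *)
Definition balanced (p q c d : R) : Prop :=
  p <> 0 /\ forall m, sin (INR m * (p * d + q)) = sin (INR m * (p * c + q)).

Lemma RInt_cos_balanced (p q c d : R) (m : nat) : balanced p q c d ->
  RInt (fun x => cos (INR (S m) * (p * x + q))) c d = 0.
Proof.
intros [Hp Hs].
assert (Hm : INR (S m) <> 0) by (apply not_0_INR; lia).
specialize (Hs (S m)); set (k := INR (S m)) in *; clearbody k.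
assert (H : is_RInt (fun x => cos (k * (p * x + q))) c d
    (minus (sin (k * (p * d + q)) / (k * p)) (sin (k * (p * c + q)) / (k * p)))).
{ apply (is_RInt_derive (V := R_CompleteNormedModule)
    (fun x => sin (k * (p * x + q)) / (k * p))).
  - intros x _; auto_derive; [auto|]. field; auto.
  - intros x _; apply continuous_cos_affine. }
apply (is_RInt_unique (V := R_CompleteNormedModule)) in H.
rewrite H, Hs; apply (minus_eq_zero (G := R_AbelianGroup)).
Qed.

Lemma RInt_Rconst (k c d : R) : RInt (fun _ => k) c d = (d - c) * k.
Proof. apply (RInt_const (V := R_CompleteNormedModule)). Qed.

Lemma RInt_fejer (N : nat) (p q c d : R) : balanced p q c d ->
  RInt (fun x => fejer N (p * x + q)) c d = d - c :> R.
Proof.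
intros Hb; unfold fejer.
rewrite (RInt_Rsum (fun m x => fejer_coef N m * cos (INR m * (p * x + q))))
  by (intros; apply continuous_scal_R, continuous_cos_affine).
assert (H0 : RInt (fun x => fejer_coef N 0 * cos (INR 0 * (p * x + q))) c d = d - c).
{ rewrite (RInt_Rext _ (fun _ => 1)), RInt_Rconst; [apply Rmult_1_r|].
  intros x; simpl; rewrite Rmult_0_l, cos_0; ring. }
induction N as [|N IH]; [exact H0|].
assert (HS : forall M m, RInt (fun x => fejer_coef M (S m) * cos (INR (S m) * (p * x + q))) c d
  = 0).
{ intros M m; rewrite RInt_Rmult, RInt_cos_balanced; [apply Rmult_0_r|exact Hb|].
  apply ex_RInt_of_continuous, continuous_cos_affine. }
rewrite decomp_sum by lia; rewrite H0.
rewrite (sum_eq _ (fun _ => 0)) by (intros; apply HS).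
rewrite sum_cte; lra.
Qed.

Lemma RInt_one_minus_cos (m : nat) (p q c d : R) : balanced p q c d ->
  RInt (fun x => 1 - cos (INR (S m) * (p * x + q))) c d = d - c :> R.
Proof.
intros Hb.
rewrite RInt_Rminus, RInt_cos_balanced, RInt_Rconst; auto; [lra| |];
  apply ex_RInt_of_continuous; intros x; [apply continuous_const|apply continuous_cos_affine].
Qed.

Definition fejer2 (N : nat) (p1 q1 p2 q2 : R) (p : R * R) : R :=
  fejer N (p1 * fst p + q1) * fejer N (p2 * snd p + q2).

Lemma continuous2_fejer2 (N : nat) (p1 q1 p2 q2 : R) : continuous2 (fejer2 N p1 q1 p2 q2).
Proof.
apply (continuous2_mult (fun p => fejer N (p1 * fst p + q1))
  (fun p => fejer N (p2 * snd p + q2))).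
- apply (continuous2_of_fst (fun x => fejer N (p1 * x + q1))); intros; apply continuous_fejer.
- apply (continuous2_of_snd (fun x => fejer N (p2 * x + q2))); intros; apply continuous_fejer.
Qed.

(* Korovkin's argument: the Fejer kernel annihilates [1 - cos] up to [1 / (N + 1)]. *)
Lemma integral2_fejer2_le (b B C : R) (w : R * R -> R) (N : nat) (p1 q1 p2 q2 : R) :
  0 <= b -> continuous2 w -> balanced p1 q1 0 1 -> balanced p2 q2 0 b ->
  (forall p, w p <= B + C * ((1 - cos (p1 * fst p + q1)) + (1 - cos (p2 * snd p + q2)))) ->
  integral2 b (fun p => w p * fejer2 N p1 q1 p2 q2 p) <= B * b + C * (2 * b / (INR N + 1)).
Proof.
intros Hb Cw H1 H2 Hw.
assert (HN := pos_INR N).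
assert (CF : forall p q x, continuous (fun x => fejer N (p * x + q)) x)
  by (intros; apply continuous_fejer).
assert (CD : forall p q x, continuous (fun x => 1 - cos (INR (S N) * (p * x + q))) x).
{ intros p q x; apply (continuous_minus (V := R_NormedModule) (fun _ => 1)).
  - apply continuous_const.
  - apply continuous_cos_affine. }
(* [g1] and [g2] are, up to the factor [N + 1], what [fejer_mult] leaves of the kernel multiplied by
   each [1 - cos]. Each has integral [b], whence [2 * b / (INR N + 1)]. *)
pose (g1 := fun p : R * R => (1 - cos (INR (S N) * (p1 * fst p + q1))) *
  fejer N (p2 * snd p + q2)).
pose (g2 := fun p : R * R => fejer N (p1 * fst p + q1) *
  (1 - cos (INR (S N) * (p2 * snd p + q2)))).
assert (Cg1 : continuous2 g1).
{ apply (continuous2_mult (fun p => 1 - cos (INR (S N) * (p1 * fst p + q1)))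
    (fun p => fejer N (p2 * snd p + q2))).
  - apply (continuous2_of_fst (fun x => 1 - cos (INR (S N) * (p1 * x + q1)))); auto.
  - apply (continuous2_of_snd (fun x => fejer N (p2 * x + q2))); auto. }
assert (Cg2 : continuous2 g2).
{ apply (continuous2_mult (fun p => fejer N (p1 * fst p + q1))
    (fun p => 1 - cos (INR (S N) * (p2 * snd p + q2)))).
  - apply (continuous2_of_fst (fun x => fejer N (p1 * x + q1))); auto.
  - apply (continuous2_of_snd (fun x => 1 - cos (INR (S N) * (p2 * x + q2)))); auto. }
assert (CF2 := continuous2_fejer2 N p1 q1 p2 q2).
apply Rle_trans with (integral2 b (fun p => B * fejer2 N p1 q1 p2 q2 p +
  C / (INR N + 1) * (g1 p + g2 p))).
- apply integral2_le; auto.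
  + apply continuous2_mult; assumption.
  + apply continuous2_plus; [apply continuous2_scal, CF2|].
    apply continuous2_scal, continuous2_plus; assumption.
  + intros p.
    apply Rle_trans with ((B + C * ((1 - cos (p1 * fst p + q1)) + (1 - cos (p2 * snd p + q2))))
      * fejer2 N p1 q1 p2 q2 p).
    * apply Rmult_le_compat_r; [|apply Hw].
      apply Rmult_le_pos; apply fejer_nonneg.
    * right; unfold fejer2, g1, g2.
      set (t1 := p1 * fst p + q1); set (t2 := p2 * snd p + q2).
      replace (1 - cos (INR (S N) * t1)) with ((INR N + 1) * ((1 - cos t1) * fejer N t1))
        by (rewrite fejer_mult; field; lra).
      replace (1 - cos (INR (S N) * t2)) with ((INR N + 1) * ((1 - cos t2) * fejer N t2))
        by (rewrite fejer_mult; field; lra).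
      field; lra.
- rewrite integral2_plus by
    (auto; try apply continuous2_scal; auto; apply continuous2_plus; assumption).
  rewrite !integral2_scal by (auto; apply continuous2_plus; assumption).
  rewrite integral2_plus by auto.
  unfold fejer2, g1, g2.
  rewrite (integral2_mult b (fun x => fejer N (p1 * x + q1)) (fun x => fejer N (p2 * x + q2)))
    by auto.
  rewrite (integral2_mult b (fun x => 1 - cos (INR (S N) * (p1 * x + q1)))
    (fun x => fejer N (p2 * x + q2))) by auto.
  rewrite (integral2_mult b (fun x => fejer N (p1 * x + q1))
    (fun x => 1 - cos (INR (S N) * (p2 * x + q2)))) by auto.
  rewrite !RInt_fejer, !RInt_one_minus_cos by assumption.
  right; field; lra.
Qed.

(** * One-sided bound of a periodic function by cosines *)

Lemma periodic_IZR (f : R -> R) (P : R) : (forall x, f (P + x) = f x) ->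
  forall (k : Z) x, f (IZR k * P + x) = f x.
Proof.
intros Hf.
assert (Hn : forall n x, f (INR n * P + x) = f x).
{ intros n; induction n as [|n IH]; intros x.
  - f_equal; simpl; ring.
  - rewrite S_INR.
    replace ((INR n + 1) * P + x) with (P + (INR n * P + x)) by ring.
    rewrite Hf; apply IH. }
intros k x; destruct (Z.le_gt_cases 0 k) as [Hk|Hk].
- rewrite <- (Z2Nat.id k Hk), <- INR_IZR_INZ; apply Hn.
- rewrite <- (Hn (Z.to_nat (- k))); f_equal.
  rewrite INR_IZR_INZ, Z2Nat.id, opp_IZR by lia; ring.
Qed.

Lemma reduce_period (P x : R) : 0 < P -> exists k : Z, Rabs (IZR k * P + x) <= P / 2.
Proof.
intros HP.
(* [up (y - / 2)] is an integer nearest to [y]. *)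
destruct (archimed (x / P - / 2)) as [H1 H2].
exists (- up (x / P - / 2))%Z; rewrite opp_IZR.
set (k := IZR (up (x / P - / 2))) in *.
assert (E : x / P * P = x) by (field; lra).
apply Rabs_le; split; nra.
Qed.

Lemma one_minus_cos_pos (d y : R) : 0 < d -> d <= Rabs y -> Rabs y <= PI ->
  0 < 1 - cos d <= 1 - cos y.
Proof.
intros Hd H1 H2.
assert (E : cos (Rabs y) = cos y) by (unfold Rabs; destruct Rcase_abs; [apply cos_neg|auto]).
rewrite <- E; split.
- rewrite <- cos_0; assert (cos d < cos 0); [|lra].
  apply cos_decreasing_1; lra.
- assert (cos (Rabs y) <= cos d); [|lra].
  apply cos_decr_1; lra.
Qed.

Lemma cos_plus_2PI (x : R) : cos (x + 2 * PI) = cos x.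
Proof. rewrite cos_plus, cos_2PI, sin_2PI; ring. Qed.

(** This is the majorant required by [integral2_fejer2_le]. Near [(a, 0)] continuity gives [eps];
    away from it, modulo the periods, one of the two [1 - cos] is bounded below while [w] exceeds
    [w (a, 0)] by at most [2 * M]. *)
Lemma le_at_point_plus_cos (b a eps : R) (w : R * R -> R) :
  0 < b -> 0 < eps -> continuous2 w ->
  (forall x1 x2, w (1 + x1, x2) = w (x1, x2)) ->
  (forall x1 x2, w (x1, 2 * b + x2) = w (x1, x2)) ->
  exists C, 0 <= C /\ forall x1 x2, w (x1, x2) <= w (a, 0) + eps +
    C * ((1 - cos (2 * PI * (x1 - a))) + (1 - cos (PI / b * x2))).
Proof.
intros Hb Heps Cw Hw1 Hw2.
assert (HPI := PI_RGT_0).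
destruct (proj1 (filterlim_locally _ _) (Cw (a, 0)) (mkposreal _ Heps)) as [d Hd].
(* The bounds [/ 2] and [b] keep [2 * PI * r] and [PI / b * r] within [[0, PI]], where the cosine
   decreases. *)
assert (Hdelta : exists r, 0 < r /\ r <= d /\ r <= / 2 /\ r <= b).
{ exists (Rmin d (Rmin (/ 2) b)); assert (Hdp := cond_pos d).
  generalize (Rmin_l d (Rmin (/ 2) b)) (Rmin_r d (Rmin (/ 2) b)) (Rmin_l (/ 2) b)
    (Rmin_r (/ 2) b); intros.
  repeat split; try lra; repeat apply Rmin_glb_lt; lra. }
destruct Hdelta as [r [Hr [Hrd [Hr2 Hrb]]]].
destruct (continuous_bounded_rectangle w (a - / 2) (a + / 2) (- b) b Cw) as [M HM].
set (k1 := 1 - cos (2 * PI * r)); set (k2 := 1 - cos (PI / b * r)).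
assert (Hpr : 0 < PI / b * r) by (apply Rmult_lt_0_compat; [apply Rdiv_lt_0_compat|]; lra).
assert (Hpb : PI / b * b = PI) by (field; lra).
assert (Hpb' : 0 < PI / b) by (apply Rdiv_lt_0_compat; lra).
assert (Hk1 : 0 < k1).
{ apply (one_minus_cos_pos (2 * PI * r) (2 * PI * r)); rewrite ?Rabs_pos_eq; nra. }
assert (Hk2 : 0 < k2).
{ apply (one_minus_cos_pos (PI / b * r) (PI / b * r)); rewrite ?Rabs_pos_eq; nra. }
assert (Hk : 0 < Rmin k1 k2) by (apply Rmin_glb_lt; assumption).
assert (HM0 : 0 <= M).
{ apply Rle_trans with (Rabs (w (a, 0))); [apply Rabs_pos|apply HM; lra]. }
exists (2 * M / Rmin k1 k2); split; [apply Rdiv_le_0_compat; lra|].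
assert (Main : forall x1 x2, Rabs (x1 - a) <= / 2 -> Rabs x2 <= b ->
  w (x1, x2) <= w (a, 0) + eps + 2 * M / Rmin k1 k2 *
    ((1 - cos (2 * PI * (x1 - a))) + (1 - cos (PI / b * x2)))).
{ intros x1 x2 H1 H2.
  generalize (COS_bound (2 * PI * (x1 - a))) (COS_bound (PI / b * x2)); intros B1 B2.
  assert (HC : 0 <= 2 * M / Rmin k1 k2) by (apply Rdiv_le_0_compat; lra).
  destruct (Rlt_le_dec (Rabs (x1 - a)) r) as [L1|L1];
    [destruct (Rlt_le_dec (Rabs x2) r) as [L2|L2]|].
  - assert (Hlt : Rabs (w (x1, x2) - w (a, 0)) < eps).
    { apply (Hd (x1, x2)); split.
      - change (Rabs (x1 - a) < d); lra.
      - change (Rabs (x2 - 0) < d); rewrite Rminus_0_r; lra. }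
    apply Rabs_def2 in Hlt.
    assert (0 <= 2 * M / Rmin k1 k2 *
      ((1 - cos (2 * PI * (x1 - a))) + (1 - cos (PI / b * x2))))
      by (apply Rmult_le_pos; lra).
    lra.
  - assert (Hfar : Rmin k1 k2 <= (1 - cos (2 * PI * (x1 - a))) + (1 - cos (PI / b * x2))).
    { assert (k2 <= 1 - cos (PI / b * x2)).
      { apply (one_minus_cos_pos (PI / b * r)); auto;
          rewrite Rabs_mult, (Rabs_pos_eq (PI / b)) by lra; nra. }
      generalize (Rmin_r k1 k2); lra. }
    assert (HW := HM x1 x2); assert (HW0 := HM a 0).
    apply Rabs_le_between in H1; apply Rabs_le_between in H2.
    assert (A1 : Rabs (w (x1, x2)) <= M) by (apply HW; lra).
    assert (A0 : Rabs (w (a, 0)) <= M) by (apply HW0; lra).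
    apply Rabs_le_between in A1; apply Rabs_le_between in A0.
    assert (2 * M / Rmin k1 k2 * Rmin k1 k2 = 2 * M) by (field; lra).
    nra.
  - assert (Hfar : Rmin k1 k2 <= (1 - cos (2 * PI * (x1 - a))) + (1 - cos (PI / b * x2))).
    { assert (k1 <= 1 - cos (2 * PI * (x1 - a))).
      { apply (one_minus_cos_pos (2 * PI * r)); [nra| |];
          rewrite Rabs_mult, (Rabs_pos_eq (2 * PI)) by lra; nra. }
      generalize (Rmin_l k1 k2); lra. }
    assert (HW := HM x1 x2); assert (HW0 := HM a 0).
    apply Rabs_le_between in H1; apply Rabs_le_between in H2.
    assert (A1 : Rabs (w (x1, x2)) <= M) by (apply HW; lra).
    assert (A0 : Rabs (w (a, 0)) <= M) by (apply HW0; lra).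
    apply Rabs_le_between in A1; apply Rabs_le_between in A0.
    assert (2 * M / Rmin k1 k2 * Rmin k1 k2 = 2 * M) by (field; lra).
    nra. }
intros x1 x2.
destruct (reduce_period 1 (x1 - a)) as [j1 Hj1]; [lra|].
destruct (reduce_period (2 * b) x2) as [j2 Hj2]; [lra|].
assert (P1 := periodic_IZR (fun x => cos (2 * PI * (x - a))) 1).
assert (P2 := periodic_IZR (fun x => cos (PI / b * x)) (2 * b)).
assert (P3 := periodic_IZR (fun x => w (x, IZR j2 * (2 * b) + x2)) 1).
assert (P4 := periodic_IZR (fun x => w (x1, x)) (2 * b)).
simpl in P1, P2, P3, P4.
rewrite <- (P1) with (k := j1), <- P2 with (k := j2).
- rewrite <- P4 with (k := j2) by auto; rewrite <- P3 with (k := j1) by auto.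
  apply Main.
  + replace (IZR j1 * 1 + x1 - a) with (IZR j1 * 1 + (x1 - a)) by ring; lra.
  + lra.
- intros x; rewrite <- (cos_plus_2PI (PI / b * x)).
  f_equal; field; lra.
- intros x; rewrite <- (cos_plus_2PI (2 * PI * (x - a))); f_equal; ring.
Qed.

(** * The explicit modes *)

Lemma cos_sin_add_nPI (n : nat) (x : R) :
  cos (x + INR n * PI) = (-1) ^ n * cos x /\ sin (x + INR n * PI) = (-1) ^ n * sin x.
Proof.
induction n as [|n [IHc IHs]].
- simpl; rewrite Rmult_0_l, Rplus_0_r; split; ring.
- rewrite S_INR; replace (x + (INR n + 1) * PI) with (x + INR n * PI + PI) by ring.
  rewrite neg_cos, neg_sin, IHc, IHs; simpl; split; ring.
Qed.

Lemma pow_opp1_sqr (n : nat) : (-1) ^ n * (-1) ^ n = 1.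
Proof. rewrite <- Rpow_mult_distr; replace (-1 * -1) with 1 by ring; apply pow1. Qed.

(** The cosine centred at [a], symmetrized under [x -> 1 - x] with the sign that [mode_y] picks up.
    It equals [2 cos(2 pi m a) cos(2 pi m x)] for even [n] and [2 sin(2 pi m a) sin(2 pi m x)] for
    odd [n]; this form matches the Fejer kernel at [a] term by term. *)
Definition mode_x (a : R) (m n : nat) (x : R) : R :=
  cos (2 * PI * INR m * (x - a)) + (-1) ^ n * cos (2 * PI * INR m * (1 - x - a)).

Definition mode_y (b : R) (n : nat) (x : R) : R := cos (INR n * PI / b * x).

Lemma mode_x_reflect (a : R) (m n : nat) (x : R) :
  mode_x a m n (1 - x) = (-1) ^ n * mode_x a m n x.
Proof.
unfold mode_x; rewrite Rmult_plus_distr_l, <- Rmult_assoc, pow_opp1_sqr.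
replace (1 - (1 - x) - a) with (x - a) by ring; ring.
Qed.

Lemma mode_x_period (a : R) (m n : nat) (x : R) : mode_x a m n (1 + x) = mode_x a m n x.
Proof.
unfold mode_x; f_equal; [|f_equal].
- rewrite <- (cos_period (2 * PI * INR m * (x - a)) m); f_equal; ring.
- rewrite <- (cos_period (2 * PI * INR m * (1 - (1 + x) - a)) m); f_equal; ring.
Qed.

Lemma mode_y_shift (b : R) (n : nat) (x : R) : 0 < b ->
  mode_y b n (b + x) = (-1) ^ n * mode_y b n x.
Proof.
intros Hb; unfold mode_y.
rewrite <- (proj1 (cos_sin_add_nPI n _)); f_equal; field; lra.
Qed.

Lemma klein_mode_cos (a b : R) (m n : nat) : 0 < b ->
  klein_mode b ((2 * PI * INR m) ^ 2) ((INR n * PI / b) ^ 2) ((-1) ^ n)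
    (mode_x a m n)
    (fun x => - (2 * PI * INR m) * (sin (2 * PI * INR m * (x - a))
      - (-1) ^ n * sin (2 * PI * INR m * (1 - x - a))))
    (mode_y b n) (fun x => - (INR n * PI / b) * sin (INR n * PI / b * x)).
Proof.
intros Hb; unfold mode_x, mode_y; split.
- intros x; set (k := 2 * PI * INR m); set (s := (-1) ^ n); unfold Rminus; auto_derive; [auto|]; ring.
- intros x; set (k := 2 * PI * INR m); set (s := (-1) ^ n); unfold Rminus; auto_derive; [auto|]; ring.
- generalize (mode_x_period a m n 0); rewrite Rplus_0_r; auto.
- f_equal; f_equal; [|f_equal].
  + rewrite <- (sin_period (2 * PI * INR m * (0 - a)) m); f_equal; ring.
  + rewrite <- (sin_period (2 * PI * INR m * (1 - 1 - a)) m); f_equal; ring.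
- apply mode_x_reflect.
- intros x; set (k := INR n * PI / b); auto_derive; [auto|]; ring.
- intros x; set (k := INR n * PI / b); auto_derive; [auto|]; ring.
- rewrite Rmult_0_r; apply cos_0.
- replace (INR n * PI / b * b) with (0 + INR n * PI) by (field; lra).
  rewrite (proj1 (cos_sin_add_nPI n 0)), cos_0; ring.
- rewrite Rmult_0_r, sin_0; ring.
- replace (INR n * PI / b * b) with (0 + INR n * PI) by (field; lra).
  rewrite (proj2 (cos_sin_add_nPI n 0)), sin_0; ring.
Qed.

Lemma klein_invariant_mode (a b : R) (m n : nat) : 0 < b ->
  klein_invariant b (fun p => mode_x a m n (fst p) * mode_y b n (snd p)).
Proof.
intros Hb; split; intros x1 x2; simpl.
- rewrite mode_x_period; reflexivity.
- rewrite mode_x_reflect, mode_y_shift by exact Hb.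
  replace ((-1) ^ n * mode_x a m n x1 * ((-1) ^ n * mode_y b n x2)) with
    ((-1) ^ n * (-1) ^ n * (mode_x a m n x1 * mode_y b n x2)) by ring.
  rewrite pow_opp1_sqr; ring.
Qed.

Lemma balanced_x (a : R) : balanced (2 * PI) (- (2 * PI * a)) 0 1.
Proof.
assert (HPI := PI_RGT_0); split; [lra|]; intros m.
rewrite <- (sin_period (INR m * (2 * PI * 0 + - (2 * PI * a))) m); f_equal; ring.
Qed.

Lemma balanced_x_reflect (a : R) : balanced (- (2 * PI)) (2 * PI * (1 - a)) 0 1.
Proof.
assert (HPI := PI_RGT_0); split; [lra|]; intros m.
rewrite <- (sin_period (INR m * (- (2 * PI) * 1 + 2 * PI * (1 - a))) m); f_equal; ring.
Qed.

(** The interval is only half a period, which suffices because the sines vanish at both ends. *)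
Lemma balanced_y (b : R) (j : nat) : 0 < b -> balanced (PI / b) (INR j * PI) 0 b.
Proof.
intros Hb; assert (HPI := PI_RGT_0); split; [apply Rgt_not_eq, Rdiv_lt_0_compat; lra|].
intros m.
assert (H : forall i, sin (INR i * PI) = 0).
{ intros i; rewrite <- (Rplus_0_l (INR i * PI)), (proj2 (cos_sin_add_nPI i 0)), sin_0; ring. }
replace (INR m * (PI / b * b + INR j * PI)) with (INR (m * (1 + j)) * PI)
  by (rewrite mult_INR, plus_INR; simpl; field; lra).
replace (INR m * (PI / b * 0 + INR j * PI)) with (INR (m * j) * PI)
  by (rewrite mult_INR; ring).
rewrite !H; reflexivity.
Qed.

(** * Mode expansion of the kernels and lower bound of the mode sum *)

Lemma sum_mult (f g : nat -> R) (M N : nat) :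
  sum_f_R0 f M * sum_f_R0 g N = sum_f_R0 (fun m => sum_f_R0 (fun n => f m * g n) N) M.
Proof.
rewrite Rmult_comm, scal_sum; apply sum_eq; intros m _.
rewrite scal_sum; apply sum_eq; intros n _; ring.
Qed.

(** The second kernel is the first composed with [(x1, x2) -> (1 - x1, b + x2)]; the shift by [b]
    yields the sign [(-1) ^ n] of [mode_x]. *)
Lemma fejer2_symmetrized (a b : R) (N : nat) (p : R * R) : 0 < b ->
  fejer2 N (2 * PI) (- (2 * PI * a)) (PI / b) (INR 0 * PI) p +
  fejer2 N (- (2 * PI)) (2 * PI * (1 - a)) (PI / b) (INR 1 * PI) p =
  sum_f_R0 (fun m => sum_f_R0 (fun n => fejer_coef N m * fejer_coef N n *
    (mode_x a m n (fst p) * mode_y b n (snd p))) N) N.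
Proof.
intros Hb; unfold fejer2, fejer; rewrite !sum_mult, <- sum_plus.
apply sum_eq; intros m _; rewrite <- sum_plus; apply sum_eq; intros n _.
unfold mode_x.
replace (INR m * (2 * PI * fst p + - (2 * PI * a))) with (2 * PI * INR m * (fst p - a)) by ring.
replace (INR m * (- (2 * PI) * fst p + 2 * PI * (1 - a)))
  with (2 * PI * INR m * (1 - fst p - a)) by ring.
replace (INR n * (PI / b * snd p + INR 0 * PI)) with (INR n * PI / b * snd p)
  by (simpl; field; lra).
replace (INR n * (PI / b * snd p + INR 1 * PI)) with (INR n * PI / b * snd p + INR n * PI)
  by (simpl; field; lra).
rewrite (proj1 (cos_sin_add_nPI n _)); unfold mode_y; ring.
Qed.

Lemma sum_ge_geometric (c : nat -> R) (B z : R) (N : nat) :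
  0 <= B -> 0 <= z <= / 2 ->
  (forall n, (S n <= N)%nat -> - (B * z ^ S n) <= c (S n)) ->
  c 0%nat - 2 * B * z <= sum_f_R0 c N.
Proof.
intros HB Hz Hc.
(* The term [z ^ S M] is kept so that the induction closes: since [1 - z >= 1/2], its decrease pays
   for the next term. *)
assert (H : forall M, (M <= N)%nat -> c 0%nat - 2 * B * (z - z ^ S M) <= sum_f_R0 c M).
{ intros M; induction M as [|M IH]; intros HM.
  - simpl; lra.
  - rewrite tech5; specialize (IH ltac:(lia)); specialize (Hc M HM).
    assert (Hp : 0 <= z ^ S M) by (apply pow_le; lra).
    replace (z ^ S (S M)) with (z * z ^ S M) by reflexivity.
    assert (0 <= B * z ^ S M) by (apply Rmult_le_pos; assumption).
    nra. }
apply Rle_trans with (2 := H N (le_n N)).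
assert (0 <= B * z ^ S N) by (apply Rmult_le_pos; [exact HB|apply pow_le; lra]).
lra.
Qed.

Lemma exp_neg_le (s c : R) : 0 < c -> c <= s -> exp (- s) <= / c.
Proof.
intros Hc Hs; rewrite exp_Ropp; apply Rinv_le_contravar; [exact Hc|].
assert (H := exp_ineq1_le s); lra.
Qed.

Lemma exp_monotone (x y : R) : x <= y -> exp x <= exp y.
Proof. intros [H| ->]; [left; apply exp_increasing, H|right; reflexivity]. Qed.

Lemma exp_pow_le (m : nat) (s r : R) : s * INR m <= r -> exp (- r) <= exp (- s) ^ m.
Proof.
intros H; apply Rle_trans with (exp (- s * INR m)); [apply exp_monotone; lra|].
right; clear H; induction m as [|m IH]; [simpl; rewrite Rmult_0_r; apply exp_0|].
rewrite S_INR, Rmult_plus_distr_l, exp_plus, IH, Rmult_1_r; simpl; ring.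
Qed.

(** Makes the quadratic exponents of the modes at least linear, so that geometric sums dominate. *)
Lemma INR_le_sqr (m : nat) : INR m <= INR m ^ 2.
Proof. simpl; rewrite Rmult_1_r, <- mult_INR; apply le_INR; nia. Qed.

(* Only the modes with [m > 0] contribute, and among them [m = 1, n = 0] decays slowest. *)
Lemma mode_sum_lower_bound (b t : R) (N : nat) :
  0 < b -> (1 <= N)%nat -> 1000 <= t -> 1000 * b ^ 2 <= t ->
  exp (- (4 * PI ^ 2 * t)) * (3 / 10) <=
  sum_f_R0 (fun m => sum_f_R0 (fun n => fejer_coef N m * fejer_coef N n *
    (exp (- ((2 * PI * INR m) ^ 2 + (INR n * PI / b) ^ 2) * t) *
     (mode_x (/ 8) m n 0 - mode_x (/ 8) m n (/ 8)))) N) N.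
Proof.
intros Hb HN Ht Htb.
assert (HPI : 3 < PI) by (generalize PI2_3_2; unfold PI2; lra).
assert (HPI2 : 1 <= PI ^ 2) by (simpl; nra).
set (x := exp (- (4 * PI ^ 2 * t))); set (z := exp (- (PI ^ 2 / b ^ 2 * t))).
assert (Hb2 : 0 < b ^ 2) by (apply pow_lt, Hb).
assert (Hs2 : 1000 <= PI ^ 2 / b ^ 2 * t).
{ replace (PI ^ 2 / b ^ 2 * t) with (PI ^ 2 * (t / b ^ 2)) by (field; lra).
  assert (1000 <= t / b ^ 2) by (apply (proj1 (Rle_div_r _ _ _ Hb2)); lra). nra. }
assert (Hx : 0 < x <= / 1000) by (split; [apply exp_pos|apply exp_neg_le; nra]).
assert (Hz : 0 < z <= / 1000) by (split; [apply exp_pos|apply exp_neg_le; lra]).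
pose (e := fun m n => exp (- ((2 * PI * INR m) ^ 2 + (INR n * PI / b) ^ 2) * t)).
assert (He : forall m n, 0 < e m n <= x ^ m * z ^ n).
{ intros m n; split; [apply exp_pos|]; unfold e.
  replace (- ((2 * PI * INR m) ^ 2 + (INR n * PI / b) ^ 2) * t) with
    (- (4 * PI ^ 2 * t * INR m ^ 2) + - (PI ^ 2 / b ^ 2 * t * INR n ^ 2)) by (field; lra).
  rewrite exp_plus; apply Rmult_le_compat; try (left; apply exp_pos);
    apply exp_pow_le; try nra; apply Rmult_le_compat_l; try nra; apply INR_le_sqr. }
pose (d := fun m n => mode_x (/ 8) m n 0 - mode_x (/ 8) m n (/ 8)).
assert (Hd : forall m n, Rabs (d m n) <= 4).
{ intros m n; unfold d, mode_x.
  assert (Hsg : (-1) ^ n = 1 \/ (-1) ^ n = -1)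
    by (clear; induction n as [|n [IH|IH]]; simpl; rewrite ?IH; lra).
  generalize (COS_bound (2 * PI * INR m * (0 - / 8)))
    (COS_bound (2 * PI * INR m * (1 - 0 - / 8)))
    (COS_bound (2 * PI * INR m * (/ 8 - / 8)))
    (COS_bound (2 * PI * INR m * (1 - / 8 - / 8))); intros.
  apply Rabs_le; destruct Hsg as [-> | ->]; lra. }
pose (c := fun m n => fejer_coef N m * fejer_coef N n * (e m n * d m n)).
change (x * (3 / 10) <= sum_f_R0 (fun m => sum_f_R0 (c m) N) N).
(* 16 is 4 from the two Fejer weights times 4 from [d]. *)
assert (Hc : forall m n, (m <= N)%nat -> (n <= N)%nat -> - (16 * x ^ m * z ^ n) <= c m n).
{ intros m n Hm Hn; unfold c.
  destruct (fejer_coef_bound N m Hm) as [F1 F1']; destruct (fejer_coef_bound N n Hn) as [F2 F2'].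
  assert (F : 0 <= fejer_coef N m * fejer_coef N n <= 4) by nra.
  assert (E := He m n); assert (D := Hd m n).
  apply Rabs_le_between in D.
  assert (0 <= fejer_coef N m * fejer_coef N n * e m n <= 4 * (x ^ m * z ^ n)) by nra.
  nra. }
assert (Hrow : forall m, (m <= N)%nat -> c m 0%nat - 32 * x ^ m * z <= sum_f_R0 (c m) N).
{ intros m Hm.
  assert (Hxm : 0 <= x ^ m) by (apply pow_le; lra).
  replace (32 * x ^ m * z) with (2 * (16 * x ^ m) * z) by ring.
  apply sum_ge_geometric; [lra|lra|]; intros n Hn; apply Hc; assumption. }
rewrite decomp_sum by lia.
(* For [m = 0] the factor [mode_x] is constant in [x]: both poles give the same value. *)
assert (Z0 : sum_f_R0 (c 0%nat) N = 0).
{ rewrite (sum_eq _ (fun _ => 0)); [rewrite sum_cte; ring|].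
  intros n _; unfold c, d, mode_x; simpl; rewrite !Rmult_0_r, !Rmult_0_l; ring. }
rewrite Z0, Rplus_0_l.
(* The main term is at least [0.4 x]; the rest of row 1 costs at most [32 x z <= 0.032 x] and the
   further rows [64 x^2 <= 0.064 x], which leaves more than [0.3 x]. *)
apply Rle_trans with (sum_f_R0 (c 1%nat) N - 2 * (32 * x) * x).
(* Here [d] is [2 cos(pi/4) - 1 = sqrt 2 - 1 > 0.4], and [N >= 1] makes the Fejer weight of
   frequency 1 at least 1. *)
- assert (H10 : x * (4 / 10) <= c 1%nat 0%nat).
  { unfold c, d, mode_x; simpl fejer_coef.
    replace (e 1%nat 0%nat) with x by (unfold e, x; f_equal; simpl; field; lra).
    simpl.
    replace (2 * PI * 1 * (0 - / 8)) with (- (PI / 4)) by field.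
    replace (2 * PI * 1 * (1 - 0 - / 8)) with (- (PI / 4) + 2 * PI) by field.
    replace (2 * PI * 1 * (/ 8 - / 8)) with 0 by field.
    replace (2 * PI * 1 * (1 - / 8 - / 8)) with (- (PI / 2) + 2 * PI) by field.
    rewrite !cos_plus_2PI, !cos_neg, cos_0, cos_PI2, cos_PI4.
    assert (S2 : 7 / 10 <= 1 / sqrt 2).
    { assert (Hs : 0 < sqrt 2) by (apply sqrt_lt_R0; lra).
      assert (sqrt 2 * sqrt 2 = 2) by (apply sqrt_sqrt; lra).
      apply (proj1 (Rle_div_r _ _ _ Hs)); nra. }
    assert (HN1 : 1 <= INR N) by (apply (le_INR 1), HN).
    assert (1 / (INR N + 1) <= / 2).
    { unfold Rdiv; rewrite Rmult_1_l; apply Rinv_le_contravar; lra. }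
    assert (1 <= 2 * (1 - 1 / (INR N + 1))) by lra.
    set (al := 2 * (1 - 1 / (INR N + 1))) in *.
    assert (4 / 10 <= 1 / sqrt 2 + 1 * (1 / sqrt 2) - (1 + 1 * 0)) by lra.
    set (dd := 1 / sqrt 2 + 1 * (1 / sqrt 2) - (1 + 1 * 0)) in *.
    assert (4 / 10 <= al * dd) by nra.
    nra. }
  assert (R1 := Hrow 1%nat HN); simpl pow in R1.
  nra.
- apply (sum_ge_geometric (fun m => sum_f_R0 (c (S m)) N) (32 * x) x); [lra|lra|].
  intros m Hm.
  assert (R := Hrow (S (S m)) ltac:(lia)).
  assert (C0 := Hc (S (S m)) 0%nat ltac:(lia) ltac:(lia)); rewrite pow_O in C0.
  assert (0 <= x ^ S (S m)) by (apply pow_le; lra).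
  replace (32 * x * x ^ S m) with (32 * x ^ S (S m)) by (simpl; ring).
  set (y := x ^ S (S m)) in *.
  assert (y * z <= y * / 1000) by (apply Rmult_le_compat_l; lra).
  lra.
Qed.

(** * A minimal geodesic *)

(** Both generators preserve the set of abscissas [a + Z] united with [- a + Z]; this locates all
    lifts of the endpoints of a curve. *)
Lemma klein_eq_fst (b a : R) (p q : R * R) : klein_eq b p q ->
  (exists k : Z, fst p = a + IZR k \/ fst p = - a + IZR k) <->
  (exists k : Z, fst q = a + IZR k \/ fst q = - a + IZR k).
Proof.
intros H; induction H as [p q [-> | ->]|p|p q _ IH|p q r _ IH1 _ IH2]; simpl; try tauto.
- split; intros [k [Hk|Hk]].
  + exists (1 + k)%Z; rewrite plus_IZR; lra.
  + exists (1 + k)%Z; rewrite plus_IZR; lra.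
  + exists (k - 1)%Z; rewrite minus_IZR; lra.
  + exists (k - 1)%Z; rewrite minus_IZR; lra.
- split; intros [k [Hk|Hk]]; exists (1 - k)%Z; rewrite minus_IZR; lra.
Qed.

Lemma curve_length_ge (c : R -> R * R) : C1_curve c ->
  Rabs (fst (c 1) - fst (c 0)) <= curve_length c 1.
Proof.
intros Hc.
assert (C1 : forall s, continuous (Derive (fun r => fst (c r))) s) by apply Hc.
assert (C2 : forall s, continuous (Derive (fun r => snd (c r))) s) by apply Hc.
assert (I1 : ex_RInt (Derive (fun r => fst (c r))) 0 1) by (apply ex_RInt_of_continuous, C1).
assert (E : RInt (Derive (fun r => fst (c r))) 0 1 = fst (c 1) - fst (c 0)).
{ apply (RInt_Derive (fun r => fst (c r))); intros s _; [apply Hc|apply C1]. }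
change (Rabs (fst (c 1) - fst (c 0)) <= RInt (speed c) 0 1); rewrite <- E.
apply Rle_trans with (1 := abs_RInt_le _ 0 1 Rle_0_1 I1).
apply RInt_le; [lra| | |].
- apply ex_RInt_of_continuous; intros s; apply continuous_Rabs_comp, C1.
- apply ex_RInt_of_continuous; intros s; unfold speed.
  apply (continuous_comp (fun s => Derive (fun r => fst (c r)) s ^ 2 +
    Derive (fun r => snd (c r)) s ^ 2) sqrt); [|apply continuous_sqrt].
  apply (continuous_plus (V := R_NormedModule)
    (fun s => Derive (fun r => fst (c r)) s ^ 2));
  (simpl; apply (continuous_mult (K := R_AbsRing)); auto;
   apply (continuous_mult (K := R_AbsRing)); auto; apply continuous_const).
- intros s _; unfold speed.
  rewrite <- sqrt_Rsqr_abs; apply sqrt_le_1_alt; unfold Rsqr.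
  generalize (pow2_ge_0 (Derive (fun r => snd (c r)) s)); simpl; lra.
Qed.

Lemma klein_dist_horizontal (b : R) (c : R -> R * R) :
  C1_curve c -> fst (c 0) = / 8 -> fst (c 1) = 0 -> curve_length c 1 = / 8 ->
  klein_dist b (proj b (c 0)) (proj b (c 1)) = / 8.
Proof.
intros Hc H0 H1 Hl; unfold klein_dist.
rewrite (is_glb_Rbar_unique _ (Finite (/ 8))); [reflexivity|]; split.
(* Any lift starts above [/ 8 + Z] or [- / 8 + Z] and ends above an integer, so its abscissa changes
   by at least [/ 8]. *)
- intros l [d [Hd [Hd0 [Hd1 ->]]]]; simpl.
  apply Rle_trans with (2 := curve_length_ge d Hd).
  apply proj_inv in Hd0; apply proj_inv in Hd1.
  destruct (proj2 (klein_eq_fst b (/ 8) _ _ Hd0)) as [k Hk].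
  { exists 0%Z; left; rewrite H0; ring. }
  destruct (proj2 (klein_eq_fst b 0 _ _ Hd1)) as [j Hj].
  { exists 0%Z; left; rewrite H1; ring. }
  assert (Hjk : (j - k <= -1)%Z \/ (j - k = 0)%Z \/ (1 <= j - k)%Z) by lia.
  unfold Rabs; destruct Rcase_abs;
  (destruct Hjk as [E|[E|E]];
    [apply IZR_le in E|apply (f_equal IZR) in E|apply IZR_le in E]; rewrite minus_IZR in E;
   destruct Hk, Hj; lra).
- intros m Hm; apply Hm; exists c; auto.
Qed.

Lemma horizontal_segment_minimal (b : R) :
  minimal_geodesic b (fun s => proj b (/ 8 - s / 8, 0)) 1.
Proof.
pose (c := fun s : R => (/ 8 - s / 8, 0)).
assert (D1 : forall s, is_derive (fun r => fst (c r)) s (- / 8)).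
{ intros s; unfold c; simpl; auto_derive; auto; field. }
assert (D2 : forall s, is_derive (fun r => snd (c r)) s 0).
{ intros s; unfold c; simpl; apply (is_derive_const (V := R_NormedModule)). }
assert (E1 : forall s, Derive (fun r => fst (c r)) s = - / 8)
  by (intros; apply is_derive_unique, D1).
assert (E2 : forall s, Derive (fun r => snd (c r)) s = 0)
  by (intros; apply is_derive_unique, D2).
assert (Hl : curve_length c 1 = / 8).
{ unfold curve_length; rewrite (RInt_Rext _ (fun _ => / 8)), RInt_Rconst; [lra|].
  intros s; unfold speed; rewrite E1, E2.
  replace ((- / 8) ^ 2 + 0 ^ 2) with (/ 8 * / 8) by field; apply sqrt_square; lra. }
exists c; split; [|split].
- intros s; split; [exists (- / 8); apply D1|]; split; [exists 0; apply D2|]; split.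
  + apply (is_derive_ext (fun _ => - / 8)); [intros; symmetry; apply E1|].
    apply (is_derive_const (V := R_NormedModule)).
  + apply (is_derive_ext (fun _ => 0)); [intros; symmetry; apply E2|].
    apply (is_derive_const (V := R_NormedModule)).
- reflexivity.
- rewrite Hl; symmetry; apply (klein_dist_horizontal b c); auto; try (simpl; field).
  intros s; split; [exists (- / 8); apply D1|]; split; [exists 0; apply D2|]; split.
  + apply (continuous_ext (fun _ => - / 8)); [intros; symmetry; apply E1|].
    apply continuous_const.
  + apply (continuous_ext (fun _ => 0)); [intros; symmetry; apply E2|].
    apply continuous_const.
Qed.

(** * Comparison with the diagonal *)

Lemma heat_kernel_diagonal_lt (b : R) (K : R -> klein b -> klein b -> R) (t : R) :
  0 < b -> is_heat_kernel b K -> 1000 <= t -> 1000 * b ^ 2 <= t ->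
  K t (proj b (/ 8, 0)) (proj b (/ 8, 0)) < K t (proj b (/ 8, 0)) (proj b (0, 0)).
Proof.
intros Hb HK Ht Htb.
assert (Ht0 : 0 < t) by lra.
pose (w := fun p => K t (proj b p) (proj b (0, 0)) + -1 * K t (proj b p) (proj b (/ 8, 0))).
enough (0 < w (/ 8, 0)) by (unfold w in *; lra).
assert (CK : forall q, continuous2 (fun p => K t (proj b p) q)).
{ intros q p; destruct HK as [_ [HC _]].
  apply (continuous_comp_2 (fun _ : R * R => t) (fun p => p) (fun t p => K t (proj b p) q)).
  - apply continuous_const.
  - apply continuous_id.
  - apply (HC q), Ht0. }
assert (Cw : continuous2 w) by (apply continuous2_plus; [|apply continuous2_scal]; apply CK).
assert (Iw : klein_invariant b w).
{ apply (klein_invariant_proj b (fun k => K t k (proj b (0, 0)) + -1 * K t k (proj b (/ 8, 0)))). }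
pose (x := exp (- (4 * PI ^ 2 * t)) * (3 / 10)).
assert (Hx : 0 < x) by (apply Rmult_lt_0_compat; [apply exp_pos|lra]).
pose (phi := fun m n (p : R * R) => mode_x (/ 8) m n (fst p) * mode_y b n (snd p)).
assert (Cphi : forall m n, continuous2 (phi m n)).
{ intros m n; assert (Hm := klein_mode_cos (/ 8) b m n Hb).
  apply (continuous2_mult (fun p => mode_x (/ 8) m n (fst p)) (fun p => mode_y b n (snd p))).
  - apply continuous2_of_fst, (continuous_of_is_derive _ _ (mode_X _ _ _ _ _ _ _ _ Hm)).
  - apply continuous2_of_snd, (continuous_of_is_derive _ _ (mode_Y _ _ _ _ _ _ _ _ Hm)). }
apply Rnot_le_lt; intros Hneg.
(* Each kernel has mass [b], so the slack [x / (8 * b)] costs [x / 8] per integral. *)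
destruct (le_at_point_plus_cos b (/ 8) (x / (8 * b)) w Hb) as [C [HC0 HC]].
{ apply Rdiv_lt_0_compat; lra. }
{ exact Cw. }
{ apply Iw. }
(* The square of the glide reflection is the vertical translation by [2 * b]. *)
{ intros x1 x2; destruct Iw as [_ Iw2].
  rewrite <- (Iw2 x1 x2), <- (Iw2 (1 - x1) (b + x2)); f_equal; f_equal; ring. }
destruct (INR_unbounded (16 * b * C / x)) as [N HN].
assert (HN0 := pos_INR N).
(* The successor ensures the order at least 1 that the lower bound on the mode sum asks for. *)
set (M := S N).
assert (HM : 4 * b * C / (INR M + 1) <= x / 4).
{ unfold M; rewrite S_INR; apply Rle_div_l; [lra|].
  apply Rlt_div_l in HN; [|exact Hx]. nra. }
set (B := w (/ 8, 0) + x / (8 * b)) in *.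
assert (U1 := integral2_fejer2_le b B C w M _ _ _ _ (Rlt_le _ _ Hb) Cw
  (balanced_x (/ 8)) (balanced_y b 0 Hb)).
assert (U2 := integral2_fejer2_le b B C w M _ _ _ _ (Rlt_le _ _ Hb) Cw
  (balanced_x_reflect (/ 8)) (balanced_y b 1 Hb)).
assert (L := mode_sum_lower_bound b t M Hb ltac:(unfold M; lia) Ht Htb); fold x in L.
assert (E : integral2 b (fun p => w p * fejer2 M (2 * PI) (- (2 * PI * / 8)) (PI / b) (INR 0 * PI) p)
  + integral2 b (fun p => w p * fejer2 M (- (2 * PI)) (2 * PI * (1 - / 8)) (PI / b) (INR 1 * PI) p)
  = sum_f_R0 (fun m => sum_f_R0 (fun n => fejer_coef M m * fejer_coef M n *
    (exp (- ((2 * PI * INR m) ^ 2 + (INR n * PI / b) ^ 2) * t) *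
     (mode_x (/ 8) m n 0 - mode_x (/ 8) m n (/ 8)))) M) M).
{ rewrite <- integral2_plus; [|lra| |]; try (apply continuous2_mult; [exact Cw|apply continuous2_fejer2]).
  rewrite (integral2_ext b _ (fun p => sum_f_R0 (fun m => sum_f_R0 (fun n =>
    fejer_coef M m * fejer_coef M n * (w p * phi m n p)) M) M)).
  - assert (C1 : forall m n, continuous2 (fun p =>
      fejer_coef M m * fejer_coef M n * (w p * phi m n p)))
      by (intros; apply continuous2_scal, continuous2_mult; auto).
    rewrite (integral2_sum b (fun m p => sum_f_R0 (fun n =>
      fejer_coef M m * fejer_coef M n * (w p * phi m n p)) M));
      [|lra|intros; apply (continuous2_sum (fun n p =>
        fejer_coef M m * fejer_coef M n * (w p * phi m n p))); auto].
    apply sum_eq; intros m _.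
    rewrite (integral2_sum b (fun n p => fejer_coef M m * fejer_coef M n * (w p * phi m n p)));
      [|lra|auto].
    apply sum_eq; intros n _.
    rewrite integral2_scal; [f_equal|lra|apply continuous2_mult; auto].
    rewrite (integral2_ext b _ (fun p => K t (proj b p) (proj b (0, 0)) * phi m n p +
      -1 * (K t (proj b p) (proj b (/ 8, 0)) * phi m n p)))
      by (intros; unfold w; ring).
    assert (C2 : forall q, continuous2 (fun p => K t (proj b p) q * phi m n p))
      by (intros; apply continuous2_mult; auto).
    rewrite integral2_plus, integral2_scal; auto; try lra; [|apply continuous2_scal; auto].
    unfold phi.
    rewrite !(heat_kernel_mode b K _ _ _ _ _ _ _ t _ Hb HK (klein_mode_cos (/ 8) b m n Hb)
      (klein_invariant_mode (/ 8) b m n Hb) Ht0).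
    simpl fst; simpl snd.
    assert (Y0 := mode_Y0 _ _ _ _ _ _ _ _ (klein_mode_cos (/ 8) b m n Hb)).
    rewrite Y0; ring.
  - intros p; rewrite <- Rmult_plus_distr_l, fejer2_symmetrized by exact Hb.
    rewrite scal_sum; apply sum_eq; intros m _.
    rewrite Rmult_comm, scal_sum; apply sum_eq; intros n _; unfold phi; ring. }
rewrite <- E in L.
specialize (U1 ltac:(intros [x1 x2]; simpl fst; simpl snd;
  replace (2 * PI * x1 + - (2 * PI * / 8)) with (2 * PI * (x1 - / 8)) by ring;
  replace (PI / b * x2 + INR 0 * PI) with (PI / b * x2) by (simpl; ring);
  apply HC)).
(* The reflected kernel peaks at the glide image of [(/ 8, 0)]; invariance of [w] carries the same
   majorant there. *)
specialize (U2 ltac:(intros [x1 x2]; simpl fst; simpl snd;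
  replace (- (2 * PI) * x1 + 2 * PI * (1 - / 8)) with (2 * PI * (1 - x1 - / 8)) by ring;
  replace (PI / b * x2 + INR 1 * PI) with (PI / b * (b + x2)) by (simpl; field; lra);
  rewrite <- (proj2 Iw x1 x2); apply HC)).
assert (HB : B * b <= x / 8).
{ unfold B; replace (x / 8) with (x / (8 * b) * b) by (field; lra); nra. }
replace (C * (2 * b / (INR M + 1))) with (4 * b * C / (INR M + 1) / 2) in U1, U2
  by (field; unfold M; rewrite S_INR; lra).
(* Each integral is at most [x / 8 + x / 8], so their sum is at most [x / 2], whereas [L] bounds it
   below by [x > 0]. *)
lra.
Qed.

Theorem proposition4p4 (b : R) (hb : 0 < b)
    (K : R -> klein b -> klein b -> R) (hK : is_heat_kernel b K) :
  exists T : R, forall t : R, T < t -> ~ geodesically_decreasing b (K t).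
Proof.
(* This exceeds both thresholds, [1000] for the modes in [x1] and [1000 * b ^ 2] for those in
   [x2]. *)
exists (1000 * (1 + b ^ 2)); intros t Ht Hdec.
assert (Hb2 := pow2_ge_0 b).
assert (Hlt := heat_kernel_diagonal_lt b K t hb hK ltac:(lra) ltac:(lra)).
assert (H := Hdec (proj b (/ 8 - 0 / 8, 0)) 1 (fun s => proj b (/ 8 - s / 8, 0)) Rle_0_1
  (horizontal_segment_minimal b) eq_refl 0 1 (Rle_refl 0) Rle_0_1 (Rle_refl 1)).
simpl in H.
replace (/ 8 - 0 / 8) with (/ 8) in H by field.
replace (/ 8 - 1 / 8) with 0 in H by field.
lra.
Qed.
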